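(* Let $d\geq 1$, let $X=\ell_p(\mathbb N)$ with $p\in[1,+\infty)$ or $X=c_0(\mathbb N)$, let $\alpha\in(0,1/d)$, let $I\subset(0,+\infty)$ be $\sigma$-compact and let $(w(\lambda))_{\lambda\in I}$ be a continuous family of admissible weights on $X$. Assume that, for every compact set $I_0\subset I$, there exist $D_1,D_2,D_3>0$ and an integer $N\geq 0$ such that, for all $n\geq N$, (1) the function $a\in I_0\mapsto \sum_{i=1}^n\log\big(w_i(a)\big)$ is $D_1n^\alpha$-Lipschitz; (2) $\inf_{a\in I_0} w_1(a)\cdots w_n(a)\geq D_2\exp(D_3 n^\alpha)$. Then the family $\big(B_{w(\lambda_1)}\times\cdots\times B_{w(\lambda_d)}\big)_{\lambda=(\lambda_1,\dots,\lambda_d)\in I^d}$ of operators on $X^d$ admits a common hypercyclic algebra for the coordinatewise product.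
   Context: Sequences are complex and indexed by $n\ge 0$. A weight is a sequence $w=(w_n)_{n\geq 1}$ of positive real numbers; the weighted backward shift is $B_w(x_0,x_1,x_2,\dots)=(w_1x_1,w_2x_2,\dots)$, and $w$ is called admissible if $B_w$ is a well-defined continuous operator on $X$. For $\lambda\in I$ we write $w(\lambda)=(w_n(\lambda))_{n\ge1}$. The family is a continuous family: each $\lambda\mapsto w_n(\lambda)$ is continuous and the map $(\lambda,v)\mapsto T_\lambda(v)$ is continuous from $I^d\times X^d$ into $X^d$, where $T_\lambda=B_{w(\lambda_1)}\times\cdots\times B_{w(\lambda_d)}$, i.e. $T_\lambda(x^{(1)},\dots,x^{(d)})=(B_{w(\lambda_1)}x^{(1)},\dots,B_{w(\lambda_d)}x^{(d)})$. The coordinatewise product of sequences is $(a_n)_n\cdot(b_n)_n=(a_nb_n)_n$; $X^d$ is an algebra with this product applied in each of its $d$ components. A vector $x$ is hypercyclic for an operator $T$ if $\{T^n(x):n\geq 1\}$ is dense in the space; $HC(T)$ is the set of hypercyclic vectors of $T$. A family $(T_\lambda)_{\lambda\in\Lambda}$ of operators on a topological algebra $Y$ admits a common hypercyclic algebra if there is a non-trivial (i.e. nonzero) subalgebra $A$ of $Y$ with $A\setminus\{0\}\subset\bigcap_{\lambda\in\Lambda}HC(T_\lambda)$. *)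

(* Defs.v *)
From HB Require Import structures.
From mathcomp Require Import all_boot all_order all_algebra.
From mathcomp Require Import all_classical all_reals all_analysis.
From mathcomp.real_closed Require Import complex.
From mathcomp Require Import ring lra.

Set Implicit Arguments.
Unset Strict Implicit.
Unset Printing Implicit Defensive.

Import Order.TTheory GRing.Theory Num.Theory.
Import numFieldNormedType.Exports.

Local Open Scope classical_set_scope.
Local Open Scope complex_scope.
Local Open Scope ring_scope.

Notation normc := ComplexField.Normc.normc.

Variant seq_space (R : realType) : Type :=
  | Ell (p : R) of 1 <= p
  | C0.
Arguments C0 {R}.

Section SequenceSpace.
Variable R : realType.
Local Notation C := R[i].
Implicit Types (E : seq_space R) (x y : nat -> C).

Definition in_seq_space E x : Prop :=
  match E with
  | Ell p _ => cvgn (series (fun n => normc (x n) `^ p))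
  | C0 => normc (x n) @[n --> \oo] --> (0 : R)
  end.

Definition seq_norm E x : R :=
  match E with
  | Ell p _ => limn (series (fun n => normc (x n) `^ p)) `^ p^-1
  | C0 => sup (range (fun n => normc (x n)))
  end.

Lemma normc_ge0 (z : C) : 0 <= normc z.
Proof. by case: z => a b; rewrite /= sqrtr_ge0. Qed.

Lemma normcD (z t : C) : normc (z + t) <= normc z + normc t.
Proof. exact: le_normcD. Qed.

Lemma series_powR_ndecr (p : R) (u : nat -> R) :
  {homo series (fun n => u n `^ p) : n m / (n <= m)%N >-> n <= m}.
Proof.
apply/nondecreasing_seqP => n.
by rewrite /series /= big_nat_recr//= lerDl powR_ge0.
Qed.

Lemma ler_powR_series (p : R) (u : nat -> R) n :
  cvgn (series (fun n => u n `^ p)) ->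
  u n `^ p <= limn (series (fun n => u n `^ p)).
Proof.
move=> cu; apply: le_trans (nondecreasing_cvgn_le (@series_powR_ndecr p u) cu n.+1).
by rewrite /series /= big_nat_recr//= lerDr sumr_ge0// => i _; exact: powR_ge0.
Qed.

Lemma lim_powR_series_ge0 (p : R) (u : nat -> R) :
  cvgn (series (fun n => u n `^ p)) -> 0 <= limn (series (fun n => u n `^ p)).
Proof. by move=> /(ler_powR_series 0); apply: le_trans; exact: powR_ge0. Qed.

Lemma seq_space_bounded E x : in_seq_space E x ->
  exists2 M : R, 0 <= M & forall n, normc (x n) <= M.
Proof.
case: E => [p p1|] /= cx.
  have p0 : 0 < p by exact: (lt_le_trans ltr01 p1).
  exists (limn (series (fun n => normc (x n) `^ p)) `^ p^-1).
    exact: powR_ge0.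
  move=> n; rewrite -[leLHS](powRr1 (normc_ge0 _)) -(mulfV (lt0r_neq0 p0)).
  rewrite powRrM ge0_ler_powR ?nnegrE ?powR_ge0 ?invr_ge0 ?(ltW p0)//.
    exact: lim_powR_series_ge0.
  exact: ler_powR_series.
have /cvg_seq_bounded/pinfty_ex_gt0[M M00 xM] :
  cvgn (fun n => normc (x n)) by apply/cvg_ex; exists 0.
have {}xM n : normc (x n) <= M.
  by rewrite (le_trans _ (xM n I))// real_ler_norm ?num_real.
by exists M => //; apply: le_trans (xM 0%N); exact: normc_ge0.
Qed.

Lemma in_seq_space_bounded_mul E x y (M : R) : 0 <= M ->
  (forall n, normc (y n) <= M * normc (x n)) ->
  in_seq_space E x -> in_seq_space E y.
Proof.
move=> M0 yx; case: E => [p p1|] /= cx.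
  have p0 : 0 <= p by exact: (le_trans ler01 p1).
  apply: (@series_le_cvg _ _ (fun n => M `^ p * normc (x n) `^ p)).
  - by move=> n; exact: powR_ge0.
  - by move=> n; rewrite mulr_ge0// powR_ge0.
  - move=> n; rewrite -powRM ?normc_ge0//.
    by rewrite ge0_ler_powR ?nnegrE ?mulr_ge0 ?normc_ge0.
  - exact: (is_cvg_seriesZ (k := M `^ p) cx).
apply: (@squeeze_cvgr _ _ _ _ (fun=> 0) (fun n => M * normc (x n))).
- by apply: nearW => n; rewrite normc_ge0 yx.
- exact: cvg_cst.
- by rewrite -[X in _ --> X](mulr0 M); apply: cvgMr.
Qed.

Lemma in_seq_space0 E : in_seq_space E (0 : nat -> C).
Proof.
have n0 : normc (0 : C) = 0 :> R by exact: ComplexField.Normc.normc0.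
case: E => [p p1|]; last first.
  rewrite /in_seq_space (_ : (fun n => _) = fun=> 0); first exact: cvg_cst.
  by apply/funext => n; exact: n0.
have p0 : p != 0 by rewrite lt0r_neq0//; exact: (lt_le_trans ltr01 p1).
apply/cvg_ex; exists 0.
rewrite (_ : series _ = fun=> 0); first exact: cvg_cst.
by apply/funext => n; apply: big1 => i _; rewrite [normc _]n0 powR0.
Qed.

Lemma powR_convexD (p A B a b : R) : 1 <= p -> 0 < A -> 0 < B ->
  0 <= a -> 0 <= b ->
  ((a + b) / (A + B)) `^ p <=
    A / (A + B) * (a `^ p / A `^ p) + B / (A + B) * (b `^ p / B `^ p).
Proof.
move=> p1 A0 B0 a0 b0.
have AB0 : 0 < A + B by rewrite addr_gt0.
have t0 : 0 <= A / (A + B) by rewrite divr_ge0// ltW.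
have t1 : A / (A + B) <= 1 by rewrite ler_pdivrMr// mul1r lerDl ltW.
have tC : 1 - A / (A + B) = B / (A + B).
  by rewrite -[X in X - _](divff (lt0r_neq0 AB0)) -mulrBl addrC addKr.
have divp (u v : R) : 0 <= u -> 0 < v -> (u / v) `^ p = u `^ p / v `^ p.
  move=> u0 v0; rewrite powRM ?invr_ge0 ?(ltW v0)//.
  by rewrite -(powR_inv1 (ltW v0)) powRAC powR_inv1 ?powR_ge0.
have := @convex_powR R p p1 (Itv01 t0 t1) (a / A) (b / B).
rewrite !inE /= !in_itv /= !andbT !divr_ge0 ?(ltW A0) ?(ltW B0)//.
move=> /(_ isT isT) H; rewrite -(divp a A)// -(divp b B)//.
rewrite convRE [X in X `^ _ <= _]convRE /= /unstable.onem tC in H.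
rewrite (_ : (a + b) / (A + B) = A / (A + B) * (a / A) + B / (A + B) * (b / B))//.
by field; rewrite !lt0r_neq0.
Qed.

Lemma series_minkowski (p A B : R) (u v t : nat -> R) : 1 <= p ->
  0 < A -> 0 < B ->
  (forall n, 0 <= u n) -> (forall n, 0 <= v n) -> (forall n, 0 <= t n) ->
  (forall n, t n <= u n + v n) ->
  cvgn (series (fun n => u n `^ p)) -> cvgn (series (fun n => v n `^ p)) ->
  limn (series (fun n => u n `^ p)) <= A `^ p ->
  limn (series (fun n => v n `^ p)) <= B `^ p ->
  forall n, series (fun n => t n `^ p) n <= (A + B) `^ p.
Proof.
move=> p1 A0 B0 u0 v0 t0 tuv cu cv uA vB n.
have p0 : 0 <= p by exact: (le_trans ler01 p1).
have AB0 : 0 < A + B by rewrite addr_gt0.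
have su : series (fun n => u n `^ p) n / A `^ p <= 1.
  rewrite ler_pdivrMr ?powR_gt0// mul1r (le_trans _ uA)//.
  exact: nondecreasing_cvgn_le (@series_powR_ndecr p u) cu n.
have sv : series (fun n => v n `^ p) n / B `^ p <= 1.
  rewrite ler_pdivrMr ?powR_gt0// mul1r (le_trans _ vB)//.
  exact: nondecreasing_cvgn_le (@series_powR_ndecr p v) cv n.
rewrite -[leRHS]mul1r -ler_pdivrMr ?powR_gt0//.
apply: (@le_trans _ _ (A / (A + B) * (series (fun n => u n `^ p) n / A `^ p) +
                       B / (A + B) * (series (fun n => v n `^ p) n / B `^ p))).
  rewrite /series /= !mulr_suml !mulr_sumr -big_split/= ler_sum// => i _.
  apply: le_trans (powR_convexD p1 A0 B0 (u0 i) (v0 i)).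
  rewrite powRM ?addr_ge0 ?invr_ge0 ?(ltW AB0)//.
  rewrite -(powR_inv1 (ltW AB0)) (powRAC _ (-1) p) powR_inv1 ?powR_ge0//.
  by rewrite ler_wpM2r ?invr_ge0 ?powR_ge0// ge0_ler_powR ?nnegrE ?addr_ge0.
apply: (@le_trans _ _ (A / (A + B) * 1 + B / (A + B) * 1)).
  by rewrite lerD// ler_wpM2l// divr_ge0// ltW.
by rewrite !mulr1 -mulrDl divff// lt0r_neq0.
Qed.

Lemma seq_norm_ge0 E x : 0 <= seq_norm E x.
Proof.
case: E => [p p1|] /=; first exact: powR_ge0.
have [[_ ub]|/sup_out-> //] := pselect (has_sup (range (fun n => normc (x n)))).
by apply: le_trans (normc_ge0 (x 0%N)) _; apply: ub_le_sup => //; exists 0%N.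
Qed.

Lemma C0_has_sup x : in_seq_space C0 x -> has_sup (range (fun n => normc (x n))).
Proof.
move=> /seq_space_bounded[M _ xM]; split; first by exists (normc (x 0%N)), 0%N.
by exists M => _ [n _ <-].
Qed.

Lemma normc_le_seq_norm E x n : in_seq_space E x -> normc (x n) <= seq_norm E x.
Proof.
case: E => [p p1|] /=; last by move=> /C0_has_sup[_ ?]; apply: ub_le_sup => //; exists n.
move=> cx; have p0 : 0 < p by exact: (lt_le_trans ltr01 p1).
rewrite -[leLHS](powRr1 (normc_ge0 _)) -(mulfV (lt0r_neq0 p0)).
rewrite powRrM ge0_ler_powR ?nnegrE ?powR_ge0 ?invr_ge0 ?(ltW p0)//.
  exact: lim_powR_series_ge0.
exact: ler_powR_series.
Qed.

Lemma seq_norm_powR (p : R) (p1 : 1 <= p) x (A : R) :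
  in_seq_space (Ell p1) x -> seq_norm (Ell p1) x <= A ->
  limn (series (fun n => normc (x n) `^ p)) <= A `^ p.
Proof.
move=> /= cx xA; have p0 : 0 < p by exact: (lt_le_trans ltr01 p1).
rewrite -[leLHS]powRr1; last exact: lim_powR_series_ge0.
rewrite -(mulVf (lt0r_neq0 p0)) powRrM ge0_ler_powR ?nnegrE ?powR_ge0 ?(ltW p0)//.
by apply: le_trans xA; exact: powR_ge0.
Qed.

Lemma seq_spaceD E x y : in_seq_space E x -> in_seq_space E y ->
  in_seq_space E (x + y) /\ seq_norm E (x + y) <= seq_norm E x + seq_norm E y.
Proof.
have Dle n : normc ((x + y) n) <= normc (x n) + normc (y n) by exact: normcD.
case: E => [p p1 cx cy|cx cy]; last first.
  split.
    apply: (@squeeze_cvgr _ _ _ _ (fun=> 0) (fun n => normc (x n) + normc (y n))).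
    - by apply: nearW => n; rewrite normc_ge0 Dle.
    - exact: cvg_cst.
    - by rewrite -[X in _ --> X](addr0 0); apply: cvgD.
  apply: ge_sup; first by exists (normc ((x + y) 0%N)), 0%N.
  move=> _ [n _ <-]; rewrite (le_trans (Dle n))// lerD//.
    exact: (@normc_le_seq_norm C0).
  exact: (@normc_le_seq_norm C0).
have p0 : 0 < p by exact: (lt_le_trans ltr01 p1).
have bnd e : 0 < e -> forall n, series (fun n => normc ((x + y) n) `^ p) n <=
    (seq_norm (Ell p1) x + e + (seq_norm (Ell p1) y + e)) `^ p.
  move=> e0; apply: (@series_minkowski p _ _ (fun n => normc (x n)) (fun n => normc (y n))) => //.
  - by rewrite ltr_wpDl// seq_norm_ge0.
  - by rewrite ltr_wpDl// seq_norm_ge0.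
  - by move=> n; exact: normc_ge0.
  - by move=> n; exact: normc_ge0.
  - by move=> n; exact: normc_ge0.
  - by apply: (seq_norm_powR cx); rewrite lerDl ltW.
  - by apply: (seq_norm_powR cy); rewrite lerDl ltW.
have cxy : in_seq_space (Ell p1) (x + y).
  apply: nondecreasing_is_cvgn; first exact: series_powR_ndecr.
  by exists ((seq_norm (Ell p1) x + 1 + (seq_norm (Ell p1) y + 1)) `^ p) => _ [n _ <-]; exact: bnd.
split => //; apply/ler_addgt0Pr => e e0.
have e20 : 0 < e / 2 by rewrite divr_gt0.
set r := leRHS.
have rE : r = seq_norm (Ell p1) x + e / 2 + (seq_norm (Ell p1) y + e / 2).
  by rewrite /r [in LHS](splitr e) addrACA.
have r0 : 0 <= r by rewrite !addr_ge0 ?seq_norm_ge0// ltW.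
rewrite -(powRr1 r0) -(mulfV (lt0r_neq0 p0)) powRrM /=.
rewrite ge0_ler_powR ?nnegrE ?powR_ge0 ?invr_ge0 ?(ltW p0)//.
  exact: lim_powR_series_ge0.
by apply: limr_le => //; apply: nearW => n; rewrite rE; exact: bnd.
Qed.

Lemma seq_spaceZ E (a : C) x : in_seq_space E x -> in_seq_space E (a *: x).
Proof.
apply: (@in_seq_space_bounded_mul _ _ _ (normc a)) => [|n]; first exact: normc_ge0.
by rewrite -ComplexField.Normc.normcM.
Qed.

Lemma seq_normZ E (a : C) x : in_seq_space E x ->
  seq_norm E (a *: x) = normc a * seq_norm E x.
Proof.
have Zle (b : C) y : in_seq_space E y ->
    seq_norm E (b *: y) <= normc b * seq_norm E y.
  case: E => [p p1|] /= cy.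
    have p0 : 0 < p by exact: (lt_le_trans ltr01 p1).
    rewrite (_ : (fun n => _ `^ p) = normc b `^ p *: (fun n => normc (y n) `^ p)).
      rewrite lim_seriesZ// powRM ?powR_ge0 ?lim_powR_series_ge0//.
      by rewrite -powRrM mulfV ?lt0r_neq0// powRr1 ?normc_ge0.
    apply/funext => n /=.
    by rewrite [normc _]ComplexField.Normc.normcM powRM ?normc_ge0.
  apply: ge_sup; first by exists (normc ((b *: y) 0%N)), 0%N.
  move=> _ [n _ <-]; rewrite [normc _]ComplexField.Normc.normcM.
  by rewrite ler_wpM2l ?normc_ge0// (@normc_le_seq_norm C0).
move=> cx; apply/eqP; rewrite eq_le Zle//=.
have [->|a0] := eqVneq a 0.
  by rewrite [normc 0]ComplexField.Normc.normc0 mul0r seq_norm_ge0.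
have na0 : 0 < normc a.
  rewrite lt_neqAle normc_ge0 andbT eq_sym.
  by apply: contra_neq a0; exact: ComplexField.Normc.eq0_normc.
rewrite -ler_pdivlMl// -[normc a]invrK -[in leRHS](ComplexField.Normc.normcV a) ?invrK.
have /= := Zle a^-1 _ (seq_spaceZ a cx).
by rewrite scalerA mulVf// scale1r ComplexField.Normc.normcV.
Qed.

Lemma seq_norm_eq0 E x : in_seq_space E x -> seq_norm E x = 0 -> x = 0.
Proof.
move=> cx x0; apply/funext => n; apply: ComplexField.Normc.eq0_normc.
by apply/eqP; rewrite eq_le normc_ge0 -x0 normc_le_seq_norm.
Qed.

Lemma in_seq_spaceM E x y :
  in_seq_space E x -> in_seq_space E y -> in_seq_space E (x * y).
Proof.
move=> /seq_space_bounded[M M0 xM]; apply: in_seq_space_bounded_mul M0 _ => n.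
by rewrite [normc _]ComplexField.Normc.normcM ler_wpM2r ?normc_ge0.
Qed.

Definition seq_space_pred E : {pred nat -> C} :=
  [pred x | `[< in_seq_space E x >]].

Lemma seq_space_predP E x : reflect (in_seq_space E x) (x \in seq_space_pred E).
Proof. exact: asboolP. Qed.

Lemma seq_space_submod_closed E : GRing.submod_closed (seq_space_pred E).
Proof.
split; first by apply/seq_space_predP; exact: in_seq_space0.
move=> a x y /seq_space_predP cx /seq_space_predP cy; apply/seq_space_predP.
by apply: (seq_spaceD _ cy).1; exact: seq_spaceZ.
Qed.

HB.instance Definition _ E :=
  GRing.isSubmodClosed.Build C (nat -> C) (seq_space_pred E)
    (seq_space_submod_closed E).

Record seqX E := SeqX {
  seqX_val :> nat -> C;
  seqX_valP : seqX_val \in seq_space_pred E }.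

HB.instance Definition _ E := [isSub for @seqX_val E].
HB.instance Definition _ E := [Choice of seqX E by <:].
HB.instance Definition _ E := [SubChoice_isSubLmodule of seqX E by <:].

Lemma in_seqX E (x : seqX E) : in_seq_space E x.
Proof. exact/seq_space_predP/seqX_valP. Qed.

(* the norm of a normedModType over R[i] takes its values in R[i] *)
Definition seqX_norm E (x : seqX E) : C := (seq_norm E x)%:C.

Lemma seqX_normD E (x y : seqX E) :
  seqX_norm (x + y) <= seqX_norm x + seqX_norm y.
Proof.
rewrite /seqX_norm -rmorphD lecR.
exact: (seq_spaceD (in_seqX x) (in_seqX y)).2.
Qed.

Lemma seqX_normZ E (a : C) (x : seqX E) :
  seqX_norm (a *: x) = `|a| * seqX_norm x.
Proof.
have -> : `|a| = (normc a)%:C by [].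
rewrite /seqX_norm -rmorphM; congr (_%:C).
exact: (seq_normZ a (in_seqX x)).
Qed.

Lemma seqX_norm_eq0 E (x : seqX E) : seqX_norm x = 0 -> x = 0.
Proof.
move=> [/(seq_norm_eq0 (in_seqX x)) x0].
by apply: val_inj; rewrite /= x0.
Qed.

HB.instance Definition _ E := Lmodule_isNormed.Build C (seqX E)
  (@seqX_normD E) (@seqX_normZ E) (@seqX_norm_eq0 E).

Definition seqX_mul E (x y : seqX E) : seqX E :=
  SeqX (introT (seq_space_predP E _) (in_seq_spaceM (in_seqX x) (in_seqX y))).

End SequenceSpace.

(* X^d, with the product topology and componentwise operations *)
Definition pow (d : nat) (T : Type) : Type := 'I_d -> T.

HB.instance Definition _ (d : nat) (T : topologicalType) :=
  Topological.copy (pow d T) {ptws 'I_d -> T}.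
HB.instance Definition _ (d : nat) (K : pzRingType) (V : lmodType K) :=
  GRing.Lmodule.copy (pow d V) ('I_d -> V).
HB.instance Definition _ (d : nat) (K : numDomainType)
    (V : preTopologicalLmodType K) :=
  GRing.Lmodule.on (pow d V).

Definition pow_mul (R : realType) (E : seq_space R) (d : nat)
  (x y : pow d (seqX E)) : pow d (seqX E) := fun i => seqX_mul (x i) (y i).

(* Sequences indexed by n >= 1 are functions on nat whose value at 0 is unused *)
Definition is_weight (R : realType) (w : nat -> R) : Prop :=
  forall n, (1 <= n)%N -> 0 < w n.

Definition shift_seq (R : realType) (w : nat -> R) (x : nat -> R[i]) :
  nat -> R[i] := fun n => (w n.+1)%:C * x n.+1.

(* B_w on X, with the junk value 0 at the points whose image is not in X *)
Definition bw_shift (R : realType) (E : seq_space R) (w : nat -> R)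
  (x : seqX E) : seqX E := insubd 0 (shift_seq w x).

Definition admissible (R : realType) (E : seq_space R) (w : nat -> R) : Prop :=
  [/\ is_weight w,
      forall x : seqX E, in_seq_space E (shift_seq w x)
    & continuous (@bw_shift R E w)].

Definition prod_shift (R : realType) (E : seq_space R) (d : nat)
  (w : R -> nat -> R) (l : pow d R) (x : pow d (seqX E)) : pow d (seqX E) :=
  fun i => bw_shift (w (l i)) (x i).

Definition pow_set (T : Type) (d : nat) (A : set T) : set (pow d T) :=
  [set l | forall i, A (l i)].

Definition continuous_family (R : realType) (E : seq_space R) (d : nat)
  (I : set R) (w : R -> nat -> R) : Prop :=
  (forall n, (1 <= n)%N -> {within I, continuous (fun a => w a n)}) /\
  {within @pow_set R d I `*` setT,
    continuous (fun lx : pow d R * pow d (seqX E) =>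
                  prod_shift w lx.1 lx.2)}.

Definition sigma_compact (T : topologicalType) (A : set T) : Prop :=
  exists K : nat -> set T, (forall k, compact (K k)) /\ A = \bigcup_k K k.

Definition hypercyclic (Y : topologicalType) (T : Y -> Y) : set Y :=
  [set x | dense [set iter n T x | n in [set n | (1 <= n)%N]]].

Definition subalgebra (K : pzRingType) (Y : lmodType K) (mul : Y -> Y -> Y)
  (A : set Y) : Prop :=
  [/\ A 0,
      forall x y, A x -> A y -> A (x + y),
      forall (a : K) x, A x -> A (a *: x)
    & forall x y, A x -> A y -> A (mul x y)].

Definition common_hypercyclic_algebra (K : numDomainType)
  (Y : preTopologicalLmodType K) (mul : Y -> Y -> Y)
  (L : Type) (D : set L) (T : L -> Y -> Y) : Prop :=
  exists A : set Y,
    [/\ subalgebra mul A,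
        exists2 x, A x & x != 0
      & A `\ 0 `<=` \bigcap_(l in D) hypercyclic (T l)].

(* Main.v *)
(** Put [L a n = ln (w_1(a) ... w_n(a))]; the [n]-th iterate of the shift moves
    the coordinate [n + l] to [l] and multiplies it by [exp (L a (n+l) - L a l)].
    The algebra is generated by one vector [u], a superposition of small blocks
    with disjoint supports.  A block attached to a target [v], a power [m] and a
    parameter [mu] carries at the coordinate [t + l] an [m]-th root of
    [v_l exp (L mu l - L mu (t+l))], so that the [t]-th iterate sends [u^m] close
    to [v] for all parameters at distance [<< t^-alpha] from [mu], while higher
    powers of [u] become negligible because [u] is small: only the lowest-order
    term of a polynomial [P(u)] matters.
    To reach every parameter of a [d]-dimensional box, one needs finitely many
    landing times [t], one for each cell of side [<< t^-alpha], such that two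
    cells at distance [D] have landing times [t < t'] with
    [D t'^alpha <= C (t' - t)^alpha]; this prevents the blocks from disturbing
    each other.  Such times are read off a self-similar Cantor set whose coding
    map onto the cube is Hoelder with an exponent between [alpha] and [1/d]. *)

Require Import Defs.
From HB Require Import structures.
From mathcomp Require Import all_boot all_order all_algebra.
From mathcomp Require Import all_classical all_reals all_analysis.
From mathcomp.real_closed Require Import complex.
From mathcomp Require Import ring lra zify.

Set Implicit Arguments.
Unset Strict Implicit.
Unset Printing Implicit Defensive.

Import Order.TTheory GRing.Theory Num.Theory.
Import numFieldNormedType.Exports.

Local Open Scope classical_set_scope.
Local Open Scope complex_scope.
Local Open Scope ring_scope.

(** * Landing times *)

Section cantor.
Variables (R : realType) (d : nat).
Implicit Types (x y : 'I_d -> R) (b : R).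

Definition unit_cube x := forall i, 0 <= x i < 1.

Definition digits x : {ffun 'I_d -> bool} := [ffun i => 2^-1 <= x i].

(** The shift of binary expansions: it drops the first digit of every coordinate. *)
Definition doubling x : 'I_d -> R := fun i => 2 * x i - (digits x i)%:R.

(** Any injection of the [2 ^ d] digit vectors into the integers from 0 to [2 ^ d - 1] would do. *)
Definition digit_rank x : R := (enum_rank (digits x))%:R.

(* Interleaving the binary digits of the coordinates; for [b < 2^-d] the first
   digit at which two codes differ dominates all the following ones. *)
Fixpoint cantor_code b n x : R :=
  if n is n'.+1 then b * (digit_rank x + cantor_code b n' (doubling x)) else 0.

Lemma doubling_unit_cube x : unit_cube x -> unit_cube (doubling x).
Proof.
move=> hx i; have /andP[x0 x1] := hx i; rewrite /doubling ffunE.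
by case: (leP 2^-1 (x i)) => h /=; lra.
Qed.

Lemma digit_rank_bounds x : 0 <= digit_rank x <= 2 ^+ d - 1.
Proof.
rewrite /digit_rank ler0n /= lerBrDr natr1.
have : (enum_rank (digits x) < 2 ^ d)%N.
  by rewrite (leq_trans (ltn_ord _))// card_ffun card_bool card_ord.
by rewrite -natrX ler_nat.
Qed.

Lemma digit_rank_neq x y : digits x != digits y ->
  1 <= `|digit_rank x - digit_rank y|.
Proof.
move=> xy; have : enum_rank (digits x) != enum_rank (digits y) :> nat.
  by apply: contra xy => /eqP /val_inj /enum_rank_inj ->.
rewrite /digit_rank neq_ltn => /orP[] h.
  by rewrite distrC ger0_norm ?subr_ge0 ?ler_nat ?(ltnW h)//
    lerBrDr addrC natr1 ler_nat.
by rewrite ger0_norm ?subr_ge0 ?ler_nat ?(ltnW h)//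
    lerBrDr addrC natr1 ler_nat.
Qed.

(** A lower bound for the distance between codes with different first digits: the ranks differ by at
    least 1, the remaining codes by at most [b (2^d - 1) / (1 - b)]. *)
Definition code_gap b := b * (1 - b * 2 ^+ d) / (1 - b).

(** The upper bound is the geometric series with all digits maximal, the fixed point of
    [c |-> b (2^d - 1 + c)]. *)
Lemma cantor_code_bounds b n x : 0 < b -> b * 2 ^+ d < 1 ->
  0 <= cantor_code b n x <= b * (2 ^+ d - 1) / (1 - b).
Proof.
move=> b0 bd; have d1 : 1 <= 2 ^+ d :> R by rewrite exprn_ege1// ler1n.
have b1 : b < 1 by nra.
elim: n x => [|n IH] x /=.
  by rewrite lexx divr_ge0// ?mulr_ge0//; lra.
have /andP[c0 c1] := IH (doubling x).
have /andP[r0 r1] := digit_rank_bounds x.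
rewrite mulr_ge0 ?addr_ge0 ?(ltW b0)//=.
rewrite -mulrA ler_pM2l//.
apply: (le_trans (lerD r1 c1)).
rewrite (_ : (_ + _) = (2 ^+ d - 1) / (1 - b))//.
by field; lra.
Qed.

(** Self-similarity: while the first digits agree, doubling multiplies distances in the cube by 2
    and distances between codes by [1 / b = 2 ^ g], so both alternatives pass through the induction.
    The first arises when all [n] digits agree; the second is a Hoelder estimate of exponent [1 / g]
    for the inverse of the code. *)
Lemma cantor_code_sep (b g : R) n x y : 0 < b -> b * 2 ^+ d < 1 -> 0 < g ->
  b = 2 `^ (- g) -> unit_cube x -> unit_cube y ->
  (cantor_code b n x = cantor_code b n y /\ forall i, `|x i - y i| <= 2 ^- n) \/
  (code_gap b * b ^+ n <= `|cantor_code b n x - cantor_code b n y| /\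
   forall i, code_gap b * `|x i - y i| `^ g <=
              `|cantor_code b n x - cantor_code b n y|).
Proof.
move=> b0 bd g0 bE; have d1 : 1 <= 2 ^+ d :> R by rewrite exprn_ege1// ler1n.
have b1 : b < 1 by nra.
have gap0 : 0 < code_gap b by rewrite divr_gt0 ?mulr_gt0//; lra.
have b2 : b * 2 `^ g = 1 by rewrite bE -powRD ?addNr ?powRr0//; apply/implyP.
elim: n x y => [|n IH] x y hx hy.
  left; split=> // i; have := hx i; have := hy i => /andP[? ?] /andP[? ?].
  by rewrite expr0 invr1 ler_norml; lra.
have [e|ne] := eqVneq (digits x) (digits y); last first.
  right => /=.
  have le1 : code_gap b <= `|cantor_code b n.+1 x - cantor_code b n.+1 y|.
    rewrite /= -mulrBr normrM gtr0_norm// /code_gap -mulrA ler_pM2l//.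
    have := digit_rank_neq ne.
    have := cantor_code_bounds n (doubling x) b0 bd.
    have := cantor_code_bounds n (doubling y) b0 bd.
    set u := cantor_code _ _ _; set v := cantor_code _ _ _.
    set p := digit_rank _; set q := digit_rank _.
    move=> /andP[u0 u1] /andP[v0 v1] pq.
    have -> : (1 - b * 2 ^+ d) / (1 - b) = 1 - b * (2 ^+ d - 1) / (1 - b).
      by field; lra.
    have -> : p + v - (q + u) = p - q - (u - v) by ring.
    apply: (le_trans _ (lerB_dist _ _)).
    apply: lerB => //.
    by rewrite ler_norml; lra.
  split; first by apply: le_trans le1; rewrite ger_pMr// exprn_ile1// ltW.
  move=> i; apply: le_trans le1; rewrite ger_pMr//.
  have := hx i; have := hy i => /andP[? ?] /andP[? ?].
  rewrite (_ : 1 = (1 : R) `^ g); last by rewrite powR1.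
  by rewrite ge0_ler_powR ?nnegrE// ?(ltW g0)// ler_norml; lra.
have xyE i : x i - y i = (doubling x i - doubling y i) / 2.
  by rewrite /doubling e; field.
have cE : cantor_code b n.+1 x - cantor_code b n.+1 y =
    b * (cantor_code b n (doubling x) - cantor_code b n (doubling y)).
  by rewrite /= /digit_rank e; ring.
have [[fE dE]|[h1 h2]] := IH _ _ (doubling_unit_cube hx) (doubling_unit_cube hy).
  left; split.
    by apply/eqP; rewrite -subr_eq0 cE fE subrr mulr0.
  move=> i; rewrite xyE normrM (ger0_norm (x := 2^-1)) ?invr_ge0// exprS invfM mulrC.
  by rewrite ler_pM2l// invr_gt0.
right; rewrite cE normrM gtr0_norm//; split.
  by rewrite exprS mulrCA ler_pM2l.
move=> i; rewrite xyE normrM (ger0_norm (x := 2^-1)) ?invr_ge0//.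
rewrite powRM ?invr_ge0// -powR_inv1// -powRrM mulN1r -bE.
by rewrite mulrA mulrC ler_pM2l.
Qed.

End cantor.

Lemma bernoulli_unbounded (R : realType) (t A : R) : 1 < t ->
  exists n : nat, A <= t ^+ n.
Proof.
move=> t1; have t10 : 0 < t - 1 by lra.
have bern n : 1 + n%:R * (t - 1) <= t ^+ n.
  elim: n => [|n IH]; first by rewrite expr0 mul0r addr0.
  rewrite exprS -natr1; have n0 : 0 <= n%:R :> R by [].
  have : t * (1 + n%:R * (t - 1)) <= t * t ^+ n by rewrite ler_pM2l//; lra.
  have : 0 <= n%:R * (t - 1) * (t - 1) by rewrite !mulr_ge0// ltW.
  by move=> h1 h2; apply: le_trans h2; lra.
exists (Num.truncn (`|A| / (t - 1))).+1; apply: le_trans (bern _).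
have : `|A| / (t - 1) < (Num.truncn (`|A| / (t - 1))).+1%:R by exact: truncnS_gt.
by rewrite ltr_pdivrMr// => /ltW h; have := ler_norm A; lra.
Qed.

(* Same landing time: [x] and [y] lie in one cell. *)
Definition separating (R : realType) (d : nat) (al C : R) :=
  forall (eta : R) (N n0 s : nat), 0 < eta ->
  exists (time : ('I_d -> R) -> nat) (B : nat),
  (0 < B)%N /\
  forall x y, unit_cube x -> unit_cube y ->
  [/\ (n0 <= time x)%N, (time x + s <= B)%N &
   (time x = time y /\ forall i, `|x i - y i| * B%:R `^ al <= eta) \/
   (N%:R <= `|(time x)%:R - (time y)%:R| :> R /\ forall i,
     `|x i - y i| * B%:R `^ al <= C * `|(time x)%:R - (time y)%:R| `^ al)].

(** The time of [x] is [n] plus the integer part of [n] times its code with [L] digits. Cells have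
    side [2^-L], and [n] is of order [(eta 2^L)^(1/al)], which makes them small at scale [B^-al];
    the Hoelder estimate for the code gives the last inequality. *)
Lemma separating_ex (R : realType) (d : nat) (al : R) :
  (1 <= d)%N -> 0 < al < d%:R^-1 -> exists2 C : R, 0 < C & separating d al C.
Proof.
have n0s_le (a b e : nat) : (b + e + 1 <= a -> a + a + e <= 3 * a)%N by lia.
have time_le (a e t : nat) : (t <= a -> a + t + e <= a + a + e)%N by lia.
have time_ge (a b e t : nat) : (b + e + 1 <= a -> b <= a + t)%N by lia.
have pos (a b e : nat) : (b + e + 1 <= a -> 0 < a)%N by lia.
move=> d1 /andP[al0 ald].
have d0 : 0 < d%:R :> R by rewrite ltr0n.
(* The slack between [al] and [al'] makes the spacing of the codes, about
   [n 2^(-L/al')], unbounded while the cells keep the size [2^-L ~ n^-al]. *)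
pose al' := (al + d%:R^-1) / 2.
have al'0 : 0 < al' by rewrite /al'; lra.
have alal' : al < al' by rewrite /al'; lra.
have al'd : al' < d%:R^-1 by rewrite /al'; lra.
pose g := al'^-1; have g0 : 0 < g by rewrite invr_gt0.
(* [g > d] leaves room for [2^d] digits at the ratio [b = 2^-g]; [g < 1 / al] will make the spacing
   of the times grow with [L]. *)
have gd : d%:R < g by rewrite -[d%:R]invrK ltf_pV2// posrE invr_gt0.
have gal : g < al^-1 by rewrite ltf_pV2.
pose b : R := 2 `^ (- g).
have b0 : 0 < b by rewrite powR_gt0.
have bd : b * 2 ^+ d < 1.
  rewrite /b -powR_mulrn// -powRD; last exact/implyP.
  rewrite -[ltRHS](powRr0 (2 : R)) /powR pnatr_eq0/= ltr_expR ltr_pM2r ?ln_gt0 ?ltr1n//.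
  by lra.
have dd1 : 1 <= 2 ^+ d :> R by rewrite exprn_ege1// ler1n.
have b1 : b < 1 by nra.
have c0 : 0 < code_gap d b by rewrite divr_gt0 ?mulr_gt0//; lra.
pose c := code_gap d b.
(* The first factor comes from inverting the Hoelder estimate; 6 is 3, from [B <= 3 n], times 2,
   lost in truncating the times. *)
exists ((c^-1) `^ al' * 6 `^ al); first by rewrite mulr_gt0 ?powR_gt0 ?invr_gt0.
move=> eta N n0 s eta0.
pose th : R := 2 `^ al^-1 * b.
have th1 : 1 < th.
  rewrite /th /b -powRD; last exact/implyP.
  rewrite -[ltLHS](powRr0 (2 : R)) /powR pnatr_eq0/= ltr_expR ltr_pM2r ?ln_gt0 ?ltr1n//.
  by lra.
have eta'0 : 0 < eta `^ al^-1 by rewrite powR_gt0.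
(* The first summand places the times after [n0] with room for [s]; the second keeps distinct times
   [N] apart even after truncation. *)
pose Z : R := (n0 + s + 1)%:R + (2 * N + 2)%:R / c.
have [L hL] := bernoulli_unbounded (3 * (Z + 1) / eta `^ al^-1) th1.
(* Chosen so that [(3 q)^al = eta 2^L], while [q b^L] is a constant times [th^L], hence as large as
   desired. *)
pose q : R := (eta * 2 ^+ L) `^ al^-1 / 3.
have e2L : 0 < eta * 2 ^+ L by rewrite mulr_gt0// exprn_gt0.
have q0 : 0 <= q by rewrite divr_ge0 ?powR_ge0.
pose n := Num.truncn q.
have nq : n%:R <= q by rewrite truncn_le.
have qn : q < n%:R + 1 by rewrite natr1; exact: truncnS_gt.
have bL1 : b ^+ L <= 1 by rewrite exprn_ile1// ltW.
have bL0 : 0 < b ^+ L by rewrite exprn_gt0.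
have nZ : Z <= n%:R * b ^+ L.
  have : Z + 1 <= q * b ^+ L.
    have -> : q * b ^+ L = eta `^ al^-1 * th ^+ L / 3.
      rewrite /q powRM ?exprn_ge0 ?(ltW eta0)// /th exprMn.
      by rewrite -(powR_mulrn L (ler0n _ 2)) powRAC powR_mulrn ?powR_ge0//; field.
    by move: hL; rewrite ler_pdivrMr// mulrC; lra.
  by nra.
have c'0 : 0 < c by [].
have Z0 : 0 <= (2 * N + 2)%:R / c by rewrite divr_ge0 ?(ltW c0).
have nn : (n0 + s + 1 <= n)%N.
  by rewrite -(ler_nat R) (le_trans _ (le_trans nZ _))// ?ler_piMr// /Z lerDl.
have ncb : (2 * N + 2)%:R <= n%:R * (c * b ^+ L).
  rewrite mulrCA -ler_pdivrMl// mulrC (le_trans _ nZ)// /Z lerDr//.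
have n_gt0 := pos _ _ _ nn.
have B3 : (n + n + s <= 3 * n)%N := n0s_le _ _ _ nn.
have hB : (n + n + s)%:R `^ al <= eta * 2 ^+ L.
  have : (n + n + s)%:R <= (eta * 2 ^+ L) `^ al^-1.
    apply: (@le_trans _ _ ((3 * n)%:R)); first by rewrite ler_nat.
    by rewrite natrM; move: nq; rewrite /q; lra.
  move=> h; have -> : eta * 2 ^+ L = ((eta * 2 ^+ L) `^ al^-1) `^ al.
    by rewrite -powRrM mulVf ?lt0r_neq0// powRr1// ltW.
  by rewrite ge0_ler_powR ?nnegrE ?powR_ge0// ltW.
have hB6 : (n + n + s)%:R `^ al <= (3 * n%:R) `^ al.
  by rewrite ge0_ler_powR ?nnegrE ?(ltW al0)// -natrM ler_nat.
exists (fun x => n + Num.truncn (n%:R * cantor_code b L x))%N, (n + n + s)%N.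
split; first by rewrite !addn_gt0 n_gt0.
move=> x y hx hy.
have fle (z : 'I_d -> R) : 0 <= cantor_code b L z <= 1.
  have /andP[-> h] /= := cantor_code_bounds L z b0 bd.
  by apply: (le_trans h); rewrite ler_pdivrMr; lra.
have /andP[fx0 fx1] := fle x; have /andP[fy0 fy1] := fle y.
have /andP[tx1 tx2] := @truncn_itv R (n%:R * cantor_code b L x) (mulr_ge0 (ler0n _ _) fx0).
have /andP[ty1 ty2] := @truncn_itv R (n%:R * cantor_code b L y) (mulr_ge0 (ler0n _ _) fy0).
split.
- exact: time_ge nn.
- apply: time_le.
  by rewrite -(ler_nat R) (le_trans tx1)// ler_piMr.
have [[fE dE]|[h1 h2]] := cantor_code_sep L b0 bd g0 erefl hx hy.
  left; rewrite fE; split=> // i.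
  apply: (@le_trans _ _ (2 ^- L * (eta * 2 ^+ L))).
    by rewrite ler_pM ?powR_ge0.
  by rewrite mulrCA mulVf ?mulr1// expf_neq0.
right.
set D := `|cantor_code b L x - cantor_code b L y| in h1 h2.
have nD : (2 * N + 2)%:R <= n%:R * D.
  by apply: (le_trans ncb); rewrite ler_wpM2l.
have dt : n%:R * D - 1 <= `|(n + Num.truncn (n%:R * cantor_code b L x))%:R
    - (n + Num.truncn (n%:R * cantor_code b L y))%:R|.
  rewrite !natrD.
  rewrite -natr1 in tx2; rewrite -natr1 in ty2.
  have -> : n%:R * D = `|n%:R * cantor_code b L x - n%:R * cantor_code b L y|.
    by rewrite -mulrBr normrM ger0_norm.
  by rewrite lerBlDr; case: ler0P => ?; case: ler0P => ?; lra.
set T := `|_%:R - _%:R| in dt *.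
rewrite natrD natrM in nD; have N0 : 0 <= N%:R :> R by [].
split; first by lra.
have D1 : D <= 1 by rewrite /D ler_norml; lra.
have D0 : 0 < D by nra.
move=> i.
(* Since [D <= 1], the exponent [al'] can be lowered to [al]. *)
have xyD : `|x i - y i| <= c^-1 `^ al' * D `^ al.
  have h : `|x i - y i| `^ g <= c^-1 * D by rewrite mulrC ler_pdivlMr// mulrC.
  have : `|x i - y i| <= (c^-1 * D) `^ al'.
    rewrite -[leLHS]powRr1// -(mulVf (lt0r_neq0 al'0)) powRrM.
    by rewrite ge0_ler_powR ?nnegrE ?powR_ge0 ?(ltW al'0)// mulr_ge0 ?invr_ge0 ?ltW.
  move=> /le_trans; apply; rewrite powRM ?invr_ge0 ?(ltW c'0) ?(ltW D0)//.
  by rewrite ler_wpM2l ?powR_ge0// ger_powR ?D0 ?D1 ?(ltW alal').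
apply: (@le_trans _ _ (c^-1 `^ al' * D `^ al * (3 * n%:R) `^ al)).
  by rewrite ler_pM ?powR_ge0.
have n0R : 0 <= 3 * n%:R :> R by rewrite mulr_ge0.
have T0 : 0 <= T by rewrite normr_ge0.
rewrite -!mulrA ler_wpM2l ?powR_ge0// -(powRM _ (ltW D0) n0R) -(powRM _ (ler0n _ 6) T0).
have nT : D * (3 * n%:R) <= 6 * T by lra.
by rewrite ge0_ler_powR ?nnegrE ?(ltW al0)//; rewrite mulr_ge0// ltW.
Qed.

(** * Tails of the series of [exp (- c g^al)] *)

Lemma expRN_le_inv_sqr (R : realType) (c al : R) : 0 < c -> 0 < al ->
  exists2 A : R, 0 < A & forall g : nat, (0 < g)%N ->
    expR (- (c * g%:R `^ al)) <= A / g%:R ^+ 2.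
Proof.
move=> c0 al0.
(* With [x = c g^al], the bound [exp x >= (x / k)^k] is a multiple of [g^(al k)], and
   [al k >= 2]. *)
pose k := (Num.truncn (2 / al)).+1.
have k0 : 0 < k%:R :> R by rewrite ltr0n.
have kal : 2 <= al * k%:R.
  by rewrite -ler_pdivrMl// mulrC ltW// truncnS_gt.
exists ((k%:R / c) ^+ k); first by rewrite exprn_gt0// divr_gt0.
move=> g g0; have gR : 0 < g%:R :> R by rewrite ltr0n.
set x := c * _; have x0 : 0 < x by rewrite mulr_gt0// powR_gt0.
rewrite expRN -[X in _ <= X]invrK lef_pV2 ?posrE ?expR_gt0//; last first.
  by rewrite invr_gt0 divr_gt0 ?exprn_gt0// divr_gt0.
rewrite invfM invrK -exprVn invf_div.
have -> : x = k%:R * (x / k%:R) by field; rewrite lt0r_neq0.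
rewrite expRM_natl.
apply: (@le_trans _ _ ((x / k%:R) ^+ k)).
  have -> : x / k%:R = c / k%:R * g%:R `^ al.
    by rewrite /x; field; rewrite lt0r_neq0.
  rewrite !exprMn -!mulrA ler_wpM2l ?exprn_ge0 ?(ltW c0)//.
  rewrite ler_wpM2l ?exprn_ge0 ?invr_ge0//.
  rewrite -[_ `^ al ^+ k](powR_mulrn k (powR_ge0 _ _)) -powRrM -(powR_mulrn 2 (ltW gR)).
  by rewrite ler_powR// ler1n.
apply: lerXn2r; rewrite ?nnegrE ?expR_ge0 ?divr_ge0 ?(ltW x0)//.
by apply: le_trans (expR_ge1Dx _); rewrite lerDr.
Qed.

(** Comparison with [A / g^2], itself at most the telescoping term [A / (g - 1) - A / g]. *)
Lemma expRN_powR_tail (R : realType) (c al eps : R) : 0 < c -> 0 < al -> 0 < eps ->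
  exists N : nat, forall M, \sum_(N <= g < M) expR (- (c * g%:R `^ al)) <= eps.
Proof.
move=> c0 al0 eps0; have [A A0 hA] := expRN_le_inv_sqr c0 al0.
pose N := (Num.truncn (A / eps)).+1.
have N0 : 0 < N%:R :> R by rewrite ltr0n.
exists N.+1 => M; have [MN|NM] := leqP M N.+1.
  by rewrite big_geq// ltW.
apply: (@le_trans _ _ (\sum_(N.+1 <= g < M) (- (A / g%:R) - - (A / g.-1%:R)))).
  apply: ler_sum_nat => g /andP[Ng gM].
  have g1 : 1 < g%:R :> R by rewrite ltr1n (leq_trans _ Ng).
  have g0 : (0 < g)%N by rewrite (leq_trans _ Ng).
  apply: (le_trans (hA g g0)).
  rewrite -subn1 natrB// opprK -[_ / _ in leLHS]mulrC addrC -mulrBr [leLHS]mulrC.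
  rewrite ler_pM2l//.
  have -> : (g%:R - 1)^-1 - g%:R^-1 = ((g%:R - 1) * g%:R)^-1 :> R.
    by field; apply/andP; split; lra.
  by rewrite lef_pV2 ?posrE ?exprn_gt0 ?mulr_gt0//; nra.
rewrite (@telescope_sumr_eq _ _ _ (fun g => - (A / g.-1%:R)) _ (ltnW NM))//.
rewrite /= opprK [leLHS]addrC.
have : A / N%:R <= eps.
  by rewrite ler_pdivrMr// mulrC -ler_pdivrMr// ltW// truncnS_gt.
by apply: le_trans; rewrite gerDl oppr_le0 divr_ge0// ltW.
Qed.

(** * Blocks *)

Lemma normc_real (R : realType) (r : R) : normc (r%:C) = `|r|.
Proof. by rewrite /= expr0n addr0 sqrtr_sqr. Qed.

Lemma normcX (R : realType) (z : R[i]) n : normc (z ^+ n) = normc z ^+ n.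
Proof.
elim: n => [|n IH]; first by rewrite !expr0 ComplexField.Normc.normc1.
by rewrite !exprS ComplexField.Normc.normcM IH.
Qed.

Lemma normc_root (R : realType) (z : R[i]) m : (0 < m)%N ->
  normc (m.-root z) = normc z `^ m%:R^-1.
Proof.
move=> m0; rewrite -[in RHS](rootCK m0 z) normcX.
rewrite -powR_mulrn ?normc_ge0// -powRrM mulfV ?pnatr_eq0 -?lt0n//.
by rewrite powRr1// normc_ge0.
Qed.

Lemma sum_nat_prefix0 (R : realType) (f : nat -> R) N M :
  (forall k, (k < N)%N -> f k = 0) ->
  \sum_(0 <= k < M) f k = \sum_(N <= k < M) f k.
Proof.
move=> f0; have [NM|MN] := leqP N M.
  rewrite (big_cat_nat _ (n := N))//= big1_seq ?add0r// => k /=.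
  by rewrite mem_index_iota => /f0.
rewrite [RHS]big_geq ?(ltnW MN)// big1_seq// => k /=.
by rewrite mem_index_iota => /andP[_ kM]; rewrite f0// (ltn_trans kM).
Qed.

Lemma sum_nat_le_support (R : realType) (f : nat -> R) N M :
  (forall k, 0 <= f k) -> (forall k, (N <= k)%N -> f k = 0) ->
  \sum_(0 <= k < M) f k <= \sum_(0 <= k < N) f k.
Proof.
move=> f0 fN; have [MN|NM] := leqP M N.
  by rewrite [leRHS](big_cat_nat _ (n := M))//= lerDl sumr_ge0.
rewrite (big_cat_nat _ (n := N)) ?(ltnW NM)//= [X in _ + X]big1_seq ?addr0// => k /=.
by rewrite mem_index_iota => /andP[/fN].
Qed.

Lemma sum_nat_prefix_le (R : realType) (c : R) s M : 0 <= c ->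
  \sum_(0 <= l < M) (if (l < s)%N then c else 0) <= s%:R * c.
Proof.
move=> c0; apply: (@le_trans _ _ ((minn M s)%:R * c)).
  elim: M => [|M IH]; first by rewrite big_geq// min0n mul0r.
  rewrite big_nat_recr//=; case: ltnP => Ms.
    move: IH; rewrite (minn_idPl (ltnW Ms)) (minn_idPl Ms) -natr1 mulrDl mul1r.
    by rewrite lerD2r.
  by move: IH; rewrite (minn_idPr Ms) (minn_idPr (leqW Ms)) addr0.
by rewrite ler_wpM2r// ler_nat geq_minr.
Qed.

Lemma expR_sub1_le (R : realType) (t : R) : `|t| <= 2^-1 ->
  `|expR t - 1| <= 2 * `|t|.
Proof.
move=> t2; have h1 := expR_ge1Dx t; have h2 := expR_ge1Dx (- t).
rewrite expRN in h2.
have e0 := expR_gt0 t; have ei : expR t * (expR t)^-1 = 1 by rewrite mulfV// lt0r_neq0.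
move: t2; rewrite !ler_norml; case: (ler0P t) => ? /andP[? ?]; apply/andP; split; nra.
Qed.

Section stage.
Variables (R : realType) (d : nat) (al : R) (K : set R) (L : R -> nat -> R).
Variables (D1 D3 E C del : R) (N0 : nat) (a : 'I_d -> R).
Hypotheses (al0 : 0 < al) (D10 : 0 < D1) (D30 : 0 < D3) (C0 : 0 < C) (del0 : 0 < del).
Hypothesis (sepC : separating d al C).
Hypothesis (small_box : D1 * del * C <= D3 / 2).
Hypothesis lipL : forall n x y, (N0 <= n)%N -> K x -> K y ->
  `|L x n - L y n| <= D1 * n%:R `^ al * `|x - y|.
Hypothesis growL : forall n x, (N0 <= n)%N -> K x -> E + D3 * n%:R `^ al <= L x n.
Hypothesis boundL : forall s, exists A, forall x l, K x -> (l < s)%N -> L x l <= A.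
Hypothesis unifL : forall s (e : R), 0 < e -> exists2 rho : R, 0 < rho &
  forall x y, K x -> K y -> `|x - y| <= rho ->
  forall l, (l < s)%N -> `|L x l - L y l| <= e.

Definition in_box (lam : 'I_d -> R) :=
  forall i, K (lam i) /\ a i <= lam i < a i + del.

Let coord (lam : 'I_d -> R) : 'I_d -> R := fun i => (lam i - a i) / del.

Let coord_unit_cube lam : in_box lam -> unit_cube (coord lam).
Proof.
move=> h i; have [_ /andP[h1 h2]] := h i.
apply/andP; split; first by rewrite divr_ge0 ?subr_ge0// ltW.
by rewrite ltr_pdivrMr// mul1r; lra.
Qed.

Let coord_dist lam mu i : `|lam i - mu i| = del * `|coord lam i - coord mu i|.
Proof.
rewrite -[in RHS](gtr0_norm del0) -normrM; congr (`|_|).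
by rewrite /coord; field; rewrite lt0r_neq0.
Qed.

(** Each landing time [t] carries a block on [[t, t + s)] built for one parameter [rep t] of its
    cell. For [lam] landing at [t], three kinds of blocks occur. The block at [t] yields [v] up to
    factors [exp u] with [u] small. Earlier blocks are shifted out. A block at a later [t'] lands at
    coordinates [l >= t' - t], where the growth gains [D3 l^al] and the mismatch of parameters loses
    at most [D1 del C l^al], that is, at most half by [small_box]. *)
Lemma exists_block (v : 'I_d -> nat -> R[i]) (s m n0 : nat) (eps : R) :
  (forall i l, (s <= l)%N -> v i l = 0) -> (0 < m)%N -> 0 < eps ->
  exists (y : 'I_d -> nat -> R[i]) (B : nat),
  [/\ forall i k, ~~ (n0 <= k < B)%N -> y i k = 0,
      forall i, \sum_(0 <= k < B) normc (y i k) <= eps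
    & forall lam, in_box lam -> exists t, (n0 <= t < B)%N /\ forall i M,
       \sum_(0 <= l < M) normc ((expR (L (lam i) (t + l) - L (lam i) l))%:C *
                                y i (t + l)%N ^+ m - v i l) <= eps].
Proof.
move=> vs m0 eps0.
have [V V0 hV] : exists2 V : R, 0 < V & forall i l, normc (v i l) <= V.
  pose V := 1 + \sum_(i < d) \sum_(0 <= l < s) normc (v i l).
  have S0 i : 0 <= \sum_(0 <= l < s) normc (v i l).
    by apply: sumr_ge0 => l _; exact: normc_ge0.
  have V1 : 1 <= V by rewrite lerDl sumr_ge0.
  exists V; first exact: lt_le_trans V1.
  move=> i l; have [sl|ls] := leqP s l.
    by rewrite vs// ComplexField.Normc.normc0 (le_trans _ V1).
  rewrite /V (bigD1 i)//= (bigD1_seq l) ?mem_index_iota ?iota_uniq//=.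
  rewrite addrCA -addrA lerDl !addr_ge0// ?sumr_ge0// => k _; exact: normc_ge0.
have [A hA] := boundL s.
pose c1 := eps / 2 / s.+1%:R.
have c10 : 0 < c1 by rewrite !divr_gt0// ltr0Sn.
(* Tolerance for the exponent [u] on the block at the landing time: the cap [1/2] gives
   [|exp u - 1| <= 2 |u|], and [2 V th <= c1] is the error allowed per coordinate. *)
pose th := Num.min 2^-1 (c1 / V / 2).
have th0 : 0 < th by rewrite lt_min invr_gt0 ltr0n/= !divr_gt0.
have [rho rho0 hrho] := unifL s (divr_gt0 th0 (ltr0Sn _ 1)).
(* Each term makes one half of [u] at most [th / 2]: the first through uniform continuity at the
   coordinates below [s], the second through the Lipschitz bound at [t + l]. *)
pose eta := Num.min (rho / del) (th / 2 / (D1 * del)).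
have eta0 : 0 < eta by rewrite lt_min !divr_gt0// mulr_gt0.
(* An entry of a block at coordinate [k], before taking the root, is at most
   [K2 exp (- D3 k^al)]. *)
pose K2 := V * expR (A - E).
have K20 : 0 < K2 by rewrite mulr_gt0// expR_gt0.
have D32 : 0 < D3 / 2 by rewrite divr_gt0.
have [N1 hN1] := expRN_powR_tail D32 al0 (divr_gt0 eps0 (mulr_gt0 (ltr0Sn R 1) K20)).
pose K3 := K2 `^ m%:R^-1.
have K30 : 0 < K3 by rewrite powR_gt0.
have mR : 0 < m%:R^-1 :> R by rewrite invr_gt0 ltr0n.
have [N3 hN3] := expRN_powR_tail (mulr_gt0 D30 mR) al0 (divr_gt0 eps0 K30).
(* Minimal spacing of the landing times: [s] keeps the blocks disjoint, [N1] makes the later blocks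
   negligible, and [N0] gives access to the growth hypothesis. *)
pose N := maxn N0 (maxn N1 s).
have N0N : (N0 <= N)%N by rewrite leq_maxl.
have N1N : (N1 <= N)%N by rewrite /N maxnCA leq_maxl.
have sN : (s <= N)%N by rewrite /N !leq_max leqnn !orbT.
(* Earliest landing time; [N3] makes the sum of the moduli of the whole family of blocks at most
   [eps]. *)
pose n1 := maxn n0 (maxn N0 N3).
have n0n1 : (n0 <= n1)%N by rewrite leq_maxl.
have N0n1 : (N0 <= n1)%N by rewrite /n1 maxnCA leq_maxl.
have N3n1 : (N3 <= n1)%N by rewrite /n1 !leq_max leqnn !orbT.
have [time [B [B0 hsep]]] := sepC N n1 s.+1 eta0.
pose T lam := time (coord lam).
pose used t := exists lam, in_box lam /\ T lam = t.
(* The default [0] is only taken at times that are not landing times. *)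
pose rep t : 'I_d -> R := xget (fun=> 0) [set lam | in_box lam /\ T lam = t].
have repP t : used t -> in_box (rep t) /\ T (rep t) = t.
  by move=> [lam h]; apply: (@xgetPex _ (fun=> 0) [set lam | in_box lam /\ T lam = t]); exists lam.
have usedB t : used t -> (n1 <= t)%N /\ (t + s < B)%N.
  move=> [lam [/coord_unit_cube h <-]]; have [h1 h2 _] := hsep _ _ h h.
  by rewrite -addnS.
have sep t t' : used t -> used t' -> t = t' \/ (t + N <= t')%N \/ (t' + N <= t)%N.
  move=> /repP[/coord_unit_cube h1 e1] /repP[/coord_unit_cube h2 e2].
  have [_ _] := hsep _ _ h1 h2; rewrite -/(T _) -/(T _) e1 e2 => -[[-> _]|[h _]]; [by left|right].
  have [tt|tt] := leqP t t'.
    left; move: h; rewrite distrC -natrB// ger0_norm// ler_nat => h.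
    by rewrite -leq_subRL.
  right; move: h; rewrite -natrB ?(ltnW tt)// ger0_norm// ler_nat => h.
  by rewrite -leq_subRL// ltnW.
pose val i t l := m.-root (v i l * (expR (L (rep t i) l - L (rep t i) (t + l)%N))%:C).
(* Blocks are disjoint, so the chosen [t] is the only landing time whose block contains [k]. *)
pose y i k := if pselect (exists t, [/\ used t, (t <= k)%N & (k < t + s)%N]) is left h
  then let t := projT1 (cid h) in val i t (k - t)%N else 0.
have yE i t l : used t -> (l < s)%N -> y i (t + l)%N = val i t l.
  move=> ut ls; rewrite /y; case: pselect => [h|[]]; last first.
    by exists t; split; rewrite ?leq_addr ?ltn_add2l.
  case: cid => t' /= [ut' t't tt'].
  have [->|[h1|h1]] := sep _ _ ut ut'; first by rewrite addKn.
    by exfalso; have := leq_trans h1 t't; rewrite leq_add2l leqNgt (leq_trans ls).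
  exfalso; move: tt'; rewrite ltnNge (leq_trans _ (leq_addr l t))//.
  by rewrite (leq_trans _ h1)// leq_add2l.
have ycase i k : y i k = 0 \/ exists t l, [/\ used t, (l < s)%N, k = (t + l)%N & y i k = val i t l].
  have [[t [ut tk kt]]|h] := pselect (exists t, [/\ used t, (t <= k)%N & (k < t + s)%N]).
    have kE : k = (t + (k - t))%N by rewrite subnKC.
    have ls : (k - t < s)%N by rewrite ltn_subLR.
    by right; exists t, (k - t)%N; split; rewrite // {1}kE yE.
  by left; rewrite /y; case: pselect.
have nval i t l : normc (val i t l) =
    (normc (v i l) * expR (L (rep t i) l - L (rep t i) (t + l)%N)) `^ m%:R^-1.
  by rewrite normc_root// ComplexField.Normc.normcM normc_real ger0_norm// expR_ge0.
have valX i t l : val i t l ^+ m = v i l * (expR (L (rep t i) l - L (rep t i) (t + l)%N))%:C.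
  by rewrite rootCK.
exists y, B; split.
- move=> i k; apply: contraNeq => yk; have [/eqP e|[t [l [ut ls -> _]]]] := ycase i k.
    by rewrite e in yk.
  have [n1t tB] := usedB t ut.
  rewrite (leq_trans (leq_trans n0n1 n1t) (leq_addr _ _))/=.
  by rewrite (leq_trans _ tB)// ltnS leq_add2l ltnW.
- move=> i.
  have yle k : normc (y i k) <= if (N3 <= k)%N then K3 * expR (- (D3 * m%:R^-1 * k%:R `^ al)) else 0.
    have [->|[t [l [ut ls kE ->]]]] := ycase i k.
      rewrite ComplexField.Normc.normc0; case: ifP => // _.
      by rewrite mulr_ge0 ?expR_ge0 ?ltW.
    have [n1t tB] := usedB t ut.
    have n1k : (n1 <= k)%N by rewrite kE (leq_trans n1t)// leq_addr.
    rewrite (leq_trans N3n1 n1k) nval -kE.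
    have -> : - (D3 * m%:R^-1 * k%:R `^ al) = - (D3 * k%:R `^ al) * m%:R^-1 by ring.
    have -> : expR (- (D3 * k%:R `^ al) * m%:R^-1) = expR (- (D3 * k%:R `^ al)) `^ m%:R^-1.
      by rewrite -expRM.
    rewrite -powRM ?expR_ge0 ?(ltW K20)//.
    have h : normc (v i l) * expR (L (rep t i) l - L (rep t i) k) <=
        K2 * expR (- (D3 * k%:R `^ al)).
      rewrite /K2 -mulrA -expRD ler_pM ?normc_ge0 ?expR_ge0// ler_expR.
      have [hb _] := repP t ut; have [Kr _] := hb i.
      have := hA _ _ Kr ls; have := growL (leq_trans N0n1 n1k) Kr; lra.
    rewrite ge0_ler_powR ?nnegrE ?(ltW mR)// mulr_ge0 ?normc_ge0 ?expR_ge0//.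
    by rewrite ltW.
  apply: (@le_trans _ _ (\sum_(0 <= k < B) if (N3 <= k)%N then
      K3 * expR (- (D3 * m%:R^-1 * k%:R `^ al)) else 0)); first by apply: ler_sum.
  rewrite (sum_nat_prefix0 (N := N3)); last by move=> k; rewrite ltnNge => /negbTE ->.
  rewrite (eq_big_nat _ _ (F2 := fun k => K3 * expR (- (D3 * m%:R^-1 * k%:R `^ al)))).
    by rewrite -mulr_sumr -ler_pdivlMl// [leRHS]mulrC; exact: hN3.
  by move=> k /andP[-> _].
move=> lam hlam; exists (T lam).
have ut : used (T lam) by exists lam.
have [n1t tB] := usedB _ ut; split.
  rewrite (leq_trans n0n1 n1t)/=; apply: leq_trans tB; exact: leq_addr.
move=> i M; set t := T lam.
have [hr rE] := repP _ ut.
have Klam : K (lam i) by have [] := hlam i.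
(* The first sum pays for the block at [t], the second for the later blocks, which land at
   coordinates [l >= N]. *)
apply: (@le_trans _ _ (\sum_(0 <= l < M) (if (l < s)%N then c1 else 0) +
  \sum_(0 <= l < M) (if (N <= l)%N then K2 * expR (- (D3 / 2 * l%:R `^ al)) else 0))); last first.
  rewrite [leRHS]splitr lerD//.
    apply: (le_trans (sum_nat_prefix_le _ _ (ltW c10))).
    by rewrite /c1 mulrCA ler_piMr ?divr_ge0 ?(ltW eps0)// ler_pdivrMr// mul1r ler_nat.
  rewrite (sum_nat_prefix0 (N := N)); last by move=> k; rewrite ltnNge => /negbTE ->.
  rewrite (eq_big_nat _ _ (F2 := fun k => K2 * expR (- (D3 / 2 * k%:R `^ al)))); last first.
    by move=> k /andP[-> _].
  rewrite -mulr_sumr -ler_pdivlMl// [leRHS]mulrC -mulrA -invfM.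
  apply: le_trans (hN1 M).
  have [NM|MN] := leqP N M; last by rewrite big_geq ?(ltnW MN)// sumr_ge0// => k _; exact: expR_ge0.
  rewrite [leRHS](big_cat_nat _ (n := N))//= lerDr sumr_ge0// => k _; exact: expR_ge0.
rewrite -big_split/=; apply: ler_sum => l _.
have [ls|sl] := ltnP l s.
  rewrite leqNgt (leq_trans ls sN) addr0 yE// valX.
  have -> : (expR (L (lam i) (t + l)%N - L (lam i) l))%:C *
     (v i l * (expR (L (rep t i) l - L (rep t i) (t + l)%N))%:C) - v i l =
     v i l * (expR ((L (lam i) (t + l)%N - L (rep t i) (t + l)%N) + (L (rep t i) l - L (lam i) l)) - 1)%:C.
    rewrite rmorphB/= rmorph1 mulrBr mulr1 mulrCA -rmorphM/= -expRD.
    by congr (_ * (expR _)%:C - _); ring.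
  set u := (X in expR X).
  have uth : `|u| <= th.
    have hd : `|lam i - rep t i| * B%:R `^ al <= del * eta.
      have [_ _ [[_ h]|[h _]]] := hsep _ _ (coord_unit_cube hlam) (coord_unit_cube hr).
        by rewrite (coord_dist lam) -mulrA ler_pM2l.
      (* Equal times in the second alternative would force [N = 0], against [l < s <= N]. *)
      move: h; rewrite -/(T lam) -/(T (rep t)) rE subrr normr0 lern0 => /eqP N00.
      by exfalso; move: ls; rewrite ltnNge (leq_trans sN)// N00.
    have B1 : 1 <= B%:R `^ al.
      apply: (@le_trans _ _ (1 `^ al)); first by rewrite powR1.
      by rewrite ge0_ler_powR ?(ltW al0) ?nnegrE ?ler1n.
    have hd1 : `|lam i - rep t i| <= del * eta.
      by apply: le_trans hd; rewrite ler_peMr.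
    have Kr : K (rep t i) by have [] := hr i.
    rewrite (splitr th) (le_trans (ler_normD _ _))// lerD//.
      apply: (le_trans (lipL _ Klam Kr)).
        by rewrite (leq_trans N0n1)// (leq_trans n1t)// leq_addr.
      apply: (@le_trans _ _ (D1 * (del * eta))).
        rewrite -mulrA ler_pM2l// mulrC (le_trans _ hd)// ler_wpM2l//.
        rewrite ge0_ler_powR ?nnegrE ?(ltW al0)// ler_nat.
        by rewrite (leq_trans _ (ltnW tB))// leq_add2l ltnW.
      have : eta <= th / 2 / (D1 * del) by rewrite /eta ge_min lexx orbT.
      by rewrite ler_pdivlMr ?mulr_gt0// mulrC mulrA.
    apply: hrho => //; rewrite distrC (le_trans hd1)//.
    have : eta <= rho / del by rewrite /eta ge_min lexx.
    by rewrite ler_pdivlMr// mulrC.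
  have uth2 : `|u| <= 2^-1 by rewrite (le_trans uth)// /th ge_min lexx.
  rewrite ComplexField.Normc.normcM normc_real.
  apply: (@le_trans _ _ (V * (2 * th))).
    rewrite ler_pM ?normc_ge0// (le_trans (expR_sub1_le uth2))// ler_pM2l//.
  have : th <= c1 / V / 2 by rewrite /th ge_min lexx orbT.
  by rewrite !ler_pdivlMr//; lra.
rewrite vs// subr0 add0r.
have [->|[t' [l' [ut' ls' kE ->]]]] := ycase i (t + l)%N.
  rewrite expr0n eqn0Ngt m0 mulr0 ComplexField.Normc.normc0; case: ifP => // _.
  by rewrite mulr_ge0 ?expR_ge0 ?ltW.
have [hr' rE'] := repP _ ut'.
(* The coordinate cannot belong to the block at [t], because [l >= s], nor to an earlier one, which
   ends before [t]. *)
have tNt : (t + N <= t')%N.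
  have [h|[//|h]] := sep _ _ ut ut'.
    by exfalso; move: kE; rewrite /t h => /addnI e; move: ls'; rewrite -e ltnNge sl.
  exfalso; have : (t' + l' < t' + N)%N by rewrite ltn_add2l (leq_trans ls').
  by rewrite -kE ltnNge (leq_trans h)// leq_addr.
have tt' : (t <= t')%N by apply: leq_trans tNt; exact: leq_addr.
have lE : l = (t' - t + l')%N.
  by apply/eqP; rewrite -(eqn_add2l t) kE addnA subnKC.
have Nl : (N <= l)%N by rewrite lE (leq_trans _ (leq_addr _ _))// leq_subRL.
rewrite Nl valX !ComplexField.Normc.normcM !normc_real !(ger0_norm (expR_ge0 _)).
rewrite -kE mulrCA -expRD /K2 -mulrA -expRD ler_pM ?normc_ge0 ?expR_ge0//.
rewrite ler_expR.
have Kr : K (rep t' i) by have [] := hr' i.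
have g1 := growL (leq_trans N0N Nl) Klam.
have g2 := hA _ _ Kr ls'.
(* This is where the separation of the cells acts: [|lam - rep t'| B^al] is at most
   [del C (t' - t)^al], and [t' - t <= l]. *)
have l1 : L (lam i) (t + l)%N - L (rep t' i) (t + l)%N <= D3 / 2 * l%:R `^ al.
  apply: (le_trans (ler_norm _)).
  apply: (le_trans (lipL _ Klam Kr)).
    by rewrite (leq_trans N0n1)// (leq_trans n1t)// leq_addr.
  have kB : (t + l <= B)%N.
    by have [_ h] := usedB _ ut'; rewrite kE (leq_trans _ (ltnW h))// leq_add2l ltnW.
  have [_ _ [[h _]|[_ h]]] := hsep _ _ (coord_unit_cube hlam) (coord_unit_cube hr').
    exfalso; move: h; rewrite -/(T lam) -/(T (rep t')) rE' -/t => h.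
    by move: kE; rewrite h => /addnI e; move: ls'; rewrite -e ltnNge sl.
  have {}h := h i; rewrite -/(T lam) -/(T (rep t')) rE' -/t in h.
  have dE : `|t%:R - t'%:R| = (t' - t)%:R :> R.
    by rewrite distrC -natrB// ger0_norm.
  rewrite dE in h.
  apply: (@le_trans _ _ (D1 * del * (`|coord lam i - coord (rep t') i| * B%:R `^ al))).
    rewrite (coord_dist lam) -!mulrA ler_pM2l// mulrCA ler_pM2l// mulrC ler_wpM2l//.
    by rewrite ge0_ler_powR ?nnegrE ?(ltW al0)// ler_nat.
  apply: (@le_trans _ _ (D1 * del * (C * l%:R `^ al))).
    rewrite ler_pM2l ?mulr_gt0// (le_trans h)// ler_pM2l//.
    by rewrite ge0_ler_powR ?nnegrE ?(ltW al0)// ler_nat lE leq_addr.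
  by rewrite mulrA ler_wpM2r ?powR_ge0.
lra.
Qed.

End stage.

(** * Sequence spaces *)

Section l1.
Variables (R : realType) (E : seq_space R).
Implicit Types (x : nat -> R[i]).

Lemma powR_series_le (p : R) x (A : R) : 0 < p -> 0 <= A ->
  (forall M, series (fun n => normc (x n) `^ p) M <= A `^ p) ->
  cvgn (series (fun n => normc (x n) `^ p)) /\
  limn (series (fun n => normc (x n) `^ p)) `^ p^-1 <= A.
Proof.
move=> p0 A0 h.
have c : cvgn (series (fun n => normc (x n) `^ p)).
  apply: nondecreasing_is_cvgn; first exact: series_powR_ndecr.
  by exists (A `^ p) => _ [n _ <-].
split=> //; rewrite -[leRHS]powRr1// -(mulfV (lt0r_neq0 p0)) powRrM.
rewrite ge0_ler_powR ?nnegrE ?powR_ge0 ?invr_ge0 ?(ltW p0)//.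
  exact: lim_powR_series_ge0.
by apply: limr_le => //; apply: nearW.
Qed.

(** All later estimates are made in [l^1], which embeds contractively in every space considered; for
    [l^p] this follows from [|x|^p <= |x| A^(p-1)]. *)
Lemma l1_seq_space x (A : R) :
  (forall M, \sum_(0 <= k < M) normc (x k) <= A) ->
  in_seq_space E x /\ seq_norm E x <= A.
Proof.
move=> h; have A0 : 0 <= A by have := h 0%N; rewrite big_geq.
have xA k : normc (x k) <= A.
  apply: le_trans (h k.+1); rewrite big_nat_recr//= lerDr sumr_ge0// => i _.
  exact: normc_ge0.
have cx : cvgn (series (fun n => normc (x n))).
  apply: nondecreasing_is_cvgn; last by exists A => _ [n _ <-]; exact: h.
  by apply/nondecreasing_seqP => n; rewrite /series/= big_nat_recr//= lerDl normc_ge0.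
case: E => [p p1|].
  have p0 : 0 < p by exact: (lt_le_trans ltr01 p1).
  apply: powR_series_le => // M.
  apply: (@le_trans _ _ (\sum_(0 <= k < M) normc (x k) * A `^ (p - 1))).
    apply: ler_sum => k _; rewrite -(mulr_powRB1 (normc_ge0 _) p0).
    by rewrite ler_wpM2l ?normc_ge0// ge0_ler_powR ?subr_ge0 ?nnegrE ?normc_ge0.
  by rewrite -mulr_suml -(mulr_powRB1 A0 p0) ler_wpM2r ?powR_ge0.
split; first exact: cvg_series_cvg_0.
by apply: ge_sup; [exists (normc (x 0%N)), 0%N|move=> _ [n _ <-]].
Qed.

(** Stated for every sequence dominated by a tail of [x], which covers the truncations of [x] up to
    sign. *)
Lemma seq_space_tail x (e : R) : in_seq_space E x -> 0 < e ->
  exists s, forall y : nat -> R[i],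
    (forall k, normc (y k) <= if (s <= k)%N then normc (x k) else 0) ->
    in_seq_space E y /\ seq_norm E y <= e.
Proof.
case: E => [p p1|] /=.
  move=> cx e0; have p0 : 0 < p by exact: (lt_le_trans ltr01 p1).
  have ep : 0 < e `^ p by rewrite powR_gt0.
  have /cvgrPdist_lt/(_ _ ep)[s _ hs] := cx.
  exists s => y hy; apply: powR_series_le => // [|M]; first exact: ltW.
  apply: (@le_trans _ _ (\sum_(s <= k < M) normc (x k) `^ p)).
    rewrite /series/= (sum_nat_prefix0 (N := s)).
      apply: ler_sum_nat => k /andP[sk _].
      rewrite ge0_ler_powR ?nnegrE ?normc_ge0 ?(ltW p0)//.
      by have := hy k; rewrite sk.
    move=> k ks; have := hy k; rewrite leqNgt ks/= => yk.
    have -> : normc (y k) = 0 by apply/eqP; rewrite eq_le yk normc_ge0.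
    by rewrite powR0// lt0r_neq0.
  have [sM|Ms] := leqP s M; last by rewrite big_geq ?(ltnW Ms)// ltW.
  have := nondecreasing_cvgn_le (@series_powR_ndecr _ p (fun n => normc (x n))) cx M.
  have := hs s (leqnn s); rewrite /series/= => hs1.
  rewrite [in X in X -> _](big_cat_nat _ (n := s))//= => h.
  have := ltW (le_lt_trans (ler_norm _) hs1).
  by apply: le_trans; rewrite lerBrDl.
move=> cx e0; have /cvgrPdist_le/(_ _ e0)[s _ hs] := cx.
exists s => y hy.
have ye k : normc (y k) <= e.
  apply: (le_trans (hy k)); case: ifP => [sk|_]; last exact: ltW.
  by have := hs k sk; rewrite sub0r normrN ger0_norm ?normc_ge0.
split.
  apply: (@squeeze_cvgr _ _ _ _ (fun=> 0) (fun n => normc (x n))) => //.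
  - apply: nearW => n; rewrite normc_ge0/= (le_trans (hy n))//.
    by case: ifP => // _; exact: normc_ge0.
  - exact: cvg_cst.
by apply: ge_sup; [exists (normc (y 0%N)), 0%N|move=> _ [n _ <-]].
Qed.

(** Finitely supported targets with rational real and imaginary parts. Lists of pairs form a
    countable type, so targets can be enumerated; the default of [nth] fills the rest with zeros. *)
Definition rat_seq (q : seq (rat * rat)) : nat -> R[i] :=
  fun k => (ratr (nth (0, 0) q k).1 +i* ratr (nth (0, 0) q k).2).

Lemma rat_seq_ge q k : (size q <= k)%N -> rat_seq q k = 0.
Proof. by move=> h; rewrite /rat_seq nth_default//= raddf0. Qed.

Lemma normc_le_ReIm (u v : R) : normc (u +i* v) <= `|u| + `|v|.
Proof.
rewrite /=.
rewrite -[leRHS]ger0_norm ?addr_ge0// -sqrtr_sqr ler_wsqrtr//.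
rewrite sqrrD !real_normK ?num_real// -addrA lerD2l lerDr.
by rewrite mulrn_wge0// mulr_ge0.
Qed.

Lemma rat_approx (z : R[i]) (e : R) : 0 < e ->
  exists q : rat * rat, normc ((ratr q.1 +i* ratr q.2) - z) <= e.
Proof.
move=> e0; have h (r : R) : exists q : rat, `|ratr q - r| <= e / 2.
  have [|q] := @rat_in_itvoo R (r - e / 2) (r + e / 2); first lra.
  by rewrite in_itv/= => /andP[h1 h2]; exists q; rewrite ler_norml; lra.
case: z => u v; have [q1 h1] := h u; have [q2 h2] := h v.
exists (q1, q2).
rewrite (_ : _ - _ = (ratr q1 - u) +i* (ratr q2 - v))//.
apply: (le_trans (normc_le_ReIm _ _)).
by rewrite (splitr e) lerD.
Qed.

(** The factor [c] is there because an iterate of [P(u)] approaches the target multiplied by the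
    lowest coefficient of [P]. *)
Lemma rat_seq_dense x (c : R[i]) (e : R) : in_seq_space E x -> c != 0 -> 0 < e ->
  exists q, in_seq_space E (fun k => c * rat_seq q k - x k) /\
    seq_norm E (fun k => c * rat_seq q k - x k) <= e.
Proof.
move=> cx c0 e0; have e2 : 0 < e / 2 by rewrite divr_gt0.
have [s hs] := seq_space_tail cx e2.
have nc0 : 0 < normc c.
  rewrite lt_neqAle normc_ge0 andbT eq_sym.
  by apply: contra_neq c0; exact: ComplexField.Normc.eq0_normc.
pose e' := e / 2 / s.+1%:R / normc c.
have e'0 : 0 < e' by rewrite !divr_gt0.
pose f k := projT1 (cid (rat_approx (c^-1 * x k) e'0)).
have fP k : normc ((ratr (f k).1 +i* ratr (f k).2) - c^-1 * x k) <= e'.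
  exact: projT2 (cid (rat_approx (c^-1 * x k) e'0)).
exists (mkseq f s).
pose y1 k := if (k < s)%N then c * rat_seq (mkseq f s) k - x k else 0.
pose y2 k := if (k < s)%N then 0 else - x k.
have -> : (fun k => c * rat_seq (mkseq f s) k - x k) = y1 + y2.
  apply/funext => k; rewrite /GRing.add /= /y1 /y2; case: ltnP => ks.
    by rewrite addr0.
  by rewrite rat_seq_ge ?size_mkseq// mulr0.
have [i2 n2] : in_seq_space E y2 /\ seq_norm E y2 <= e / 2.
  apply: hs => k; rewrite /y2; case: ltnP => ks.
    by rewrite ComplexField.Normc.normc0.
  by rewrite normcN.
have [i1 n1] : in_seq_space E y1 /\ seq_norm E y1 <= e / 2.
  apply: l1_seq_space => M.
  apply: (@le_trans _ _ (\sum_(0 <= k < M) (if (k < s)%N then e / 2 / s.+1%:R else 0))).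
    apply: ler_sum => k _; rewrite /y1; case: ltnP => ks; last first.
      by rewrite ComplexField.Normc.normc0.
    have -> : c * rat_seq (mkseq f s) k - x k =
        c * ((ratr (f k).1 +i* ratr (f k).2) - c^-1 * x k).
      by rewrite /rat_seq nth_mkseq// mulrBr mulrA mulfV// mul1r.
    rewrite ComplexField.Normc.normcM -ler_pdivlMl// [leRHS]mulrC.
    exact: fP.
  apply: (le_trans (sum_nat_prefix_le _ _ _)); first by rewrite !divr_ge0// ltW.
  by rewrite mulrCA ler_piMr ?divr_ge0 ?(ltW e0)// ler_pdivrMr// mul1r ler_nat.
have [i3 n3] := seq_spaceD i1 i2; split=> //.
by rewrite (le_trans n3)// (splitr e) lerD.
Qed.

End l1.

(** * Iterates of the weighted shift *)

Section shift.
Variables (R : realType) (E : seq_space R).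

Definition log_weight (w : nat -> R) n : R := \sum_(1 <= i < n.+1) ln (w i).

Lemma iter_bw_shift (w : nat -> R) (x : seqX E) n k : admissible E w ->
  iter n (bw_shift w) x k =
  (expR (log_weight w (n + k) - log_weight w k))%:C * x (n + k)%N.
Proof.
move=> [w0 hw _].
have vE (z : seqX E) j : bw_shift w z j = (w j.+1)%:C * z j.+1.
  by rewrite /bw_shift insubdK//; apply/seq_space_predP.
elim: n k => [|n IH] k; first by rewrite /= add0n subrr expR0 mul1r.
rewrite iterS vE IH mulrA -rmorphM/= addnS -addSn; congr (_%:C * _).
rewrite [log_weight w k.+1]/log_weight big_nat_recr//= -/(log_weight w k).
by rewrite opprD addrA [in LHS]expRD expRN lnK ?posrE ?w0// mulrCA mulfV ?mulr1// lt0r_neq0// w0.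
Qed.

End shift.

(** * Neighbourhoods and compactness *)

Section pow_nbhs.
Variables (d : nat) (T : topologicalType).

(** The filter generated by boxes converges to [z] for each coordinate topology, hence for their
    supremum, the product topology. *)
Lemma pow_nbhs_box (z : pow d T) (O : set (pow d T)) : nbhs z O ->
  exists U : 'I_d -> set T, (forall i, nbhs (z i) (U i)) /\
    forall z' : pow d T, (forall i, U i (z' i)) -> O z'.
Proof.
pose F := filter_from [set U : 'I_d -> set T | forall i, nbhs (z i) (U i)]
  (fun U => [set z' : pow d T | forall i, U i (z' i)]).
have FF : Filter F.
  apply: filter_from_filter; first by exists (fun=> setT) => i; exact: filterT.
  move=> U V hU hV; exists (fun i => U i `&` V i); first by move=> i; exact: filterI.
  by move=> z' h; split=> i; have [] := h i.
have Fz : F --> z.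
  apply/cvg_sup => i A.
  have /= -> := @nbhsE (initial_topology (fun f : 'I_d -> T => f i)) z.
  case=> B [[C oC <-] Cz] BA; apply: filterS BA _.
  exists (fun j => if j == i then C else setT) => [j|z' /(_ i)]; last by rewrite eqxx.
  by case: eqP => [->|_]; [exact: open_nbhs_nbhs|exact: filterT].
by move=> /Fz[U hU UO]; exists U; split=> // z' h; exact: UO.
Qed.

Lemma pow_nbhs_proj (z : pow d T) i (U : set T) : nbhs (z i) U ->
  nbhs z [set z' : pow d T | U (z' i)].
Proof.
move=> h; have : z --> z by exact: cvg_id.
move=> /cvg_sup/(_ i); apply.
have /= -> := @nbhsE (initial_topology (fun f : 'I_d -> T => f i)) z.
move: h; rewrite nbhsE => -[C [oC Cz] CU].
by exists ((fun f : 'I_d -> T => f i) @^-1` C); [split => //; exists C|move=> z' /CU].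
Qed.

End pow_nbhs.

Section seqX_nbhs.
Variables (R : realType) (E : seq_space R).

Lemma seqX_nbhsP (x : seqX E) (U : set (seqX E)) : nbhs x U <->
  exists2 e : R, 0 < e & forall y : seqX E, seq_norm E (fun k => y k - x k) < e -> U y.
Proof.
have nE (y : seqX E) : `|x - y| = (seq_norm E (fun k => y k - x k))%:C.
  rewrite distrC -[LHS]/((seq_norm E (seqX_val (y - x)))%:C); congr (_%:C).
split.
  move=> /nbhs_normP[e /= e0 h].
  have eR : e = (complex.Re e)%:C by rewrite RRe_real// ger0_real// ltW.
  exists (complex.Re e); first by rewrite -ltcR -eR.
  by move=> y ye; apply: h; rewrite /ball_ /= nE eR ltcR.
move=> [e e0 h]; apply/nbhs_normP; exists e%:C; first by rewrite /= ltcR.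
by move=> y; rewrite /ball_ /= nE ltcR; exact: h.
Qed.

End seqX_nbhs.

(** * Uniform control of the weights over a compact set of parameters *)

Section weights_on_compact.
Variables (R : realType) (E : seq_space R) (d : nat) (I : set R) (w : R -> nat -> R).
Hypotheses (d0 : (0 < d)%N) (wc : continuous_family E d I w).
Hypothesis wadm : forall a, I a -> admissible E (w a).

Lemma unit_vec_in_space n (t : R[i]) :
  in_seq_space E (fun k => if k == n then t else 0) /\
  seq_norm E (fun k => if k == n then t else 0) <= normc t.
Proof.
apply: l1_seq_space => M.
have [nM|Mn] := ltnP n M.
  rewrite (bigD1_seq n) ?mem_index_iota ?iota_uniq//= eqxx big1 ?addr0// => k /negbTE ->.
  exact: ComplexField.Normc.normc0.
rewrite big_nat big1 ?normc_ge0// => k /andP[_ kM].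
by rewrite ltn_eqF ?ComplexField.Normc.normc0// (leq_trans kM).
Qed.

(** Joint continuity at [(a, 0)]: for [b] near [a], every vector of norm less than some [e] is sent
    into the unit ball. Testing it on the [n]-th unit vector times [e / 2] bounds [w b n] uniformly
    in [n]. *)
Lemma weights_locally_bounded a : I a ->
  exists2 c : R, 0 < c & \forall b \near a, I b -> forall n, (1 <= n)%N -> w b n <= c.
Proof.
move=> Ia; pose i0 : 'I_d := Ordinal d0.
pose la : pow d R := fun=> a.
pose x0 : pow d (seqX E) := fun=> 0.
have v0 : prod_shift w la x0 i0 = 0.
  apply: val_inj; apply/funext => k; rewrite /prod_shift.
  have [_ h _] := wadm Ia.
  rewrite /bw_shift insubdK; last exact/seq_space_predP/h.
  by rewrite /shift_seq mulr0.
have /subspace_continuousP/(_ (la, x0)) := wc.2.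
have N : nbhs (prod_shift w la x0)
    [set z : pow d (seqX E) | seq_norm E (z i0) < 1].
  apply: (pow_nbhs_proj (U := [set z : seqX E | seq_norm E z < 1])).
  rewrite v0; apply/seqX_nbhsP; exists 1 => // y.
  by rewrite (_ : (fun k => _) = seqX_val y)//; apply/funext => k; rewrite /= subr0.
move=> /(_ (conj (fun=> Ia) Logic.I) _ N).
move=> -[[U V] /= [hU hV] UV].
have [U' [hU' U'U]] := pow_nbhs_box hU.
have [V' [hV' V'V]] := pow_nbhs_box hV.
have hV0 i : nbhs (0 : seqX E) (V' i) by exact: hV'.
have hUa i : nbhs a (U' i) by exact: hU'.
have : nbhs (0 : seqX E) [set v | forall i, V' i v] by exact: (filter_forall _ hV0).
move=> /seqX_nbhsP[e e0 he].
have Ua : \forall b \near a, forall i, U' i b by exact: (filter_forall _ hUa).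
have e2 : 0 < e / 2 by rewrite divr_gt0.
exists (e / 2)^-1; first by rewrite invr_gt0.
apply: filterS Ua => b Ub Ib n n1.
have [dE dN] := unit_vec_in_space n (e / 2)%:C.
rewrite normc_real gtr0_norm// in dN.
pose x : seqX E := SeqX (introT (seq_space_predP _ _) dE).
have Vx i : V' i x.
  apply: he; rewrite (_ : (fun k => _) = seqX_val x); last first.
    by apply/funext => k; rewrite /= subr0.
  by rewrite (le_lt_trans dN)//; lra.
have /= := UV ((fun=> b), (fun=> x)) (conj (U'U _ Ub) (V'V _ Vx)) (conj (fun=> Ib) Logic.I).
rewrite /prod_shift.
have [w0 h _] := wadm Ib.
move=> lt1; rewrite -[_^-1]mul1r ler_pdivlMr//.
apply: ltW; apply: le_lt_trans lt1.
apply: le_trans (normc_le_seq_norm n.-1 (in_seqX _)).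
rewrite /bw_shift insubdK; last exact/seq_space_predP/h.
rewrite /shift_seq/= prednK// eqxx -rmorphM normc_real gtr0_norm//.
by rewrite mulr_gt0// w0.
Qed.

Lemma weights_bounded K : compact K -> K `<=` I ->
  exists2 c : R, 1 <= c & forall a, K a -> forall n, (1 <= n)%N -> w a n <= c.
Proof.
move=> /compact_near_coveringP/near_covering_withinP cK KI.
have H : \forall c \near +oo, K `<=` (fun a => forall n, (1 <= n)%N -> w a n <= c).
  apply: cK => a Ka; have [c c0 hc] := weights_locally_bounded (KI _ Ka).
  exists ([set b | I b -> forall n, (1 <= n)%N -> w b n <= c], [set c' | c <= c']).
    by split => /=; [exact: hc|apply: nbhs_pinfty_ge; exact: num_real].
  move=> [b c'] /= [h cc'] Kb n n1.
  by apply: le_trans cc'; apply: h => //; exact: KI.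
have [c [c1 hc]] := filter_ex (filterI (nbhs_pinfty_ge (num_real (1 : R))) H).
by exists c => // a Ka; exact: hc.
Qed.

(** Heine's theorem, by a covering argument in which the radius tends to 0 from the right. *)
Lemma within_continuous_unif (K : set R) (f : R -> R) (e : R) : compact K ->
  (forall x, K x -> f y @[y --> within K (nbhs x)] --> f x) -> 0 < e ->
  exists2 rho : R, 0 < rho & forall x y, K x -> K y -> `|x - y| <= rho ->
    `|f x - f y| <= e.
Proof.
move=> /compact_near_coveringP/near_covering_withinP cK fc e0.
have H : \forall r \near (0 : R)^'+, K `<=` (fun x => forall y, K y -> `|x - y| <= r ->
    `|f x - f y| <= e).
  apply: cK => x Kx.
  have e2 : 0 < e / 2 by rewrite divr_gt0.
  have /cvgrPdist_lt/(_ _ e2) := fc x Kx.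
  move=> /nbhs_normP[r /= r0 hr].
  have r2 : 0 < r / 2 by rewrite divr_gt0.
  exists ([set x' | `|x - x'| < r / 2], [set r' | r' < r / 2]).
    split => /=; last exact: nbhs_right_lt.
    by apply/nbhs_normP; exists (r / 2).
  move=> [x' r'] /= [xx' r'r] Kx' y Ky xy.
  have h1 : `|f x - f x'| < e / 2.
    by apply: hr => //; rewrite /ball_/=; lra.
  have h2 : `|f x - f y| < e / 2.
    apply: hr => //; rewrite /ball_/= (splitr r) (le_lt_trans (ler_distD x' x y))//.
    by apply: ltrD; [exact: xx'|exact: le_lt_trans xy r'r].
  have := ler_distD (f x) (f x') (f y); rewrite (distrC (f x') (f x)); lra.
have [r [r0 hr]] := filter_ex (filterI (nbhs_right_gt (0 : R)) H).
by exists r => // x y Kx Ky; exact: hr.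
Qed.

Lemma log_weight_continuous (K : set R) l a : K `<=` I -> K a ->
  log_weight (w b) l @[b --> within K (nbhs a)] --> log_weight (w a) l.
Proof.
move=> KI Ka; elim: l => [|l IH].
  rewrite (_ : (fun b => _) = fun=> 0); last first.
    by apply/funext => b; rewrite /log_weight big_geq.
  by rewrite /log_weight big_geq//; exact: cvg_cst.
have E1 b : log_weight (w b) l.+1 = log_weight (w b) l + ln (w b l.+1).
  by rewrite /log_weight big_nat_recr.
rewrite E1 (_ : (fun b => log_weight (w b) l.+1) =
  (fun b => log_weight (w b) l + ln (w b l.+1))); last exact/funext.
apply: cvgD => //.
have [w0 _ _] := wadm (KI _ Ka).
apply: continuous_cvg; first by apply: continuous_ln; exact: w0.
have /subspace_continuousP/(_ a (KI _ Ka)) := wc.1 l.+1 isT.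
by apply: cvg_trans; apply: cvg_app; apply: within_subset => //; exact: filterS.
Qed.

Lemma log_weight_unif (K : set R) s (e : R) : compact K -> K `<=` I -> 0 < e ->
  exists2 rho : R, 0 < rho & forall x y, K x -> K y -> `|x - y| <= rho ->
    forall l, (l < s)%N -> `|log_weight (w x) l - log_weight (w y) l| <= e.
Proof.
move=> cK KI e0; elim: s => [|s [r r0 IH]]; first by exists 1.
have [r' r'0 h] := within_continuous_unif cK (fun x => @log_weight_continuous K s x KI) e0.
exists (Num.min r r'); first by rewrite lt_min r0.
move=> x y Kx Ky; rewrite le_min => /andP[h1 h2] l.
by rewrite ltnS leq_eqVlt => /orP[/eqP->|ls]; [exact: h|exact: IH].
Qed.

Lemma log_weight_bounded (K : set R) s : compact K -> K `<=` I ->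
  exists A, forall x l, K x -> (l < s)%N -> log_weight (w x) l <= A.
Proof.
move=> cK KI; have [c c1 hc] := weights_bounded cK KI.
exists (s%:R * ln c) => x l Kx ls.
have [w0 _ _] := wadm (KI _ Kx).
have lc : 0 <= ln c by rewrite ln_ge0.
apply: (@le_trans _ _ (\sum_(1 <= i < l.+1) ln c)).
  apply: ler_sum_nat => i /andP[i1 _].
  by rewrite ler_ln ?posrE ?w0 ?(lt_le_trans ltr01)// hc.
by rewrite sumr_const_nat subn1 mulr_natl ler_wpMn2l// ltnW.
Qed.

End weights_on_compact.

(** * Superposition of blocks *)

Section superposition.
Variables (R : realType) (d : nat) (L : R -> nat -> R).
Variables (box : nat -> ('I_d -> R) -> Prop) (m : nat -> nat).
Variables (v : nat -> 'I_d -> nat -> R[i]) (c : nat -> R).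
Hypothesis m0 : forall r, (0 < m r)%N.
Hypothesis c1 : forall r, 1 <= c r.

Let coef a n l : R := expR (L a (n + l)%N - L a l).

Hypothesis coefc : forall r lam i n l, box r lam -> coef (lam i) n l <= c r ^+ n.
Hypothesis blocks : forall r (n0 : nat) (eps : R), 0 < eps ->
  exists (y : 'I_d -> nat -> R[i]) (B : nat),
  [/\ forall i k, ~~ (n0 <= k < B)%N -> y i k = 0,
      forall i, \sum_(0 <= k < B) normc (y i k) <= eps
    & forall lam, box r lam -> exists t, (n0 <= t < B)%N /\ forall i M,
       \sum_(0 <= l < M) normc ((coef (lam i) t l)%:C *
                                y i (t + l)%N ^+ m r - v r i l) <= eps].

(** A sum instead of a maximum: it only has to dominate every [c q] with [q <= r]. *)
Let cmax r : R := \sum_(0 <= q < r.+1) c q.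

Let cmax_ge q r : (q <= r)%N -> c q <= cmax r.
Proof.
move=> qr; rewrite /cmax (bigD1_seq q) ?mem_index_iota ?iota_uniq//= lerDl.
by rewrite sumr_ge0// => k _; apply: le_trans (c1 k).
Qed.

Let cmax1 r : 1 <= cmax r.
Proof. exact: le_trans (c1 r) (cmax_ge (leqnn r)). Qed.

(* Fewer than [N] shifts enlarge a block by a factor less than [cmax r ^+ N]
   for all the boxes met so far. *)
Let eps r N : R := 2 ^- r / cmax r ^+ N.

Let eps0 r N : 0 < eps r N.
Proof. by rewrite divr_gt0 ?invr_gt0 ?exprn_gt0// (lt_le_trans ltr01). Qed.

Let eps_le r N : eps r N <= 2 ^- r.
Proof. by rewrite ler_piMr ?invr_ge0 ?exprn_ge0// invf_le1 ?exprn_ege1// exprn_gt0// (lt_le_trans ltr01). Qed.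

Let yB r N : {yB : ('I_d -> nat -> R[i]) * nat |
  [/\ forall i k, ~~ (N <= k < yB.2)%N -> yB.1 i k = 0,
      forall i, \sum_(0 <= k < yB.2) normc (yB.1 i k) <= eps r N
    & forall lam, box r lam -> exists t, (N <= t < yB.2)%N /\ forall i M,
       \sum_(0 <= l < M) normc ((coef (lam i) t l)%:C *
                                yB.1 i (t + l)%N ^+ m r - v r i l) <= eps r N]}.
Proof. by apply: cid; have [y [B h]] := blocks r N (eps0 r N); exists (y, B). Qed.

(** Block [r] lives on [[start r, start r.+1)]. The value 1 at the beginning leaves the coordinate 0
    free, and the maximum forces strict growth. *)
Let start := fix start r :=
  if r is r'.+1 then maxn (sval (yB r' (start r'))).2 (start r').+1 else 1%N.

Let y r := (sval (yB r (start r))).1.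

Let startS r : (start r < start r.+1)%N.
Proof. by rewrite /= leq_maxr. Qed.

Let start_mono r q : (r <= q)%N -> (start r <= start q)%N.
Proof.
elim: q => [|q IH]; first by rewrite leqn0 => /eqP->.
by rewrite leq_eqVlt => /orP[/eqP->//|/IH h]; apply: leq_trans h (ltnW (startS q)).
Qed.

Let start_gt r : (r < start r)%N.
Proof. by elim: r => // r IH; apply: leq_ltn_trans IH (startS r). Qed.

Let y_supp r i k : ~~ (start r <= k < start r.+1)%N -> y r i k = 0.
Proof.
move=> h; have [+ _ _] := svalP (yB r (start r)); apply.
apply: contra h => /andP[-> h]/=; apply: leq_trans h _.
by rewrite /= leq_maxl.
Qed.

Let y_sum r i M : \sum_(0 <= k < M) normc (y r i k) <= eps r (start r).
Proof.
have [supp sm _] := svalP (yB r (start r)); set B := (sval _).2 in supp sm.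
apply: le_trans (sm i); apply: sum_nat_le_support => k; first exact: normc_ge0.
move=> Bk; rewrite /y supp ?ComplexField.Normc.normc0//.
by rewrite negb_and -(leqNgt B k) Bk orbT.
Qed.

(* Every iterate forgets the coordinate 0, whose only role is [u != 0]. *)
Definition superposition : 'I_d -> nat -> R[i] :=
  fun i k => if k == 0%N then 1 else \sum_(0 <= r < k) y r i k.

Local Notation u := superposition.

(** As [r < start r], the sum over [r < k] contains every block that can be nonzero at [k]; at most
    one of them is. *)
Let uE r i k : (start r <= k < start r.+1)%N -> u i k = y r i k.
Proof.
move=> /andP[rk kr]; have k0 : (0 < k)%N by apply: leq_trans rk; apply: leq_trans (start_gt r).
rewrite /u (gtn_eqF k0) (bigD1_seq r) ?iota_uniq//=; last first.
  by rewrite mem_index_iota/= (leq_trans (start_gt r)).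
rewrite big1 ?addr0// => q qr; apply: y_supp.
move: qr; rewrite neq_ltn => /orP[qr|rq].
  by rewrite negb_and -(leqNgt (start q.+1)) (leq_trans (start_mono qr))// orbT.
by rewrite negb_and -ltnNge (leq_trans kr)// start_mono.
Qed.

Let locate k : (0 < k)%N -> exists r, (start r <= k < start r.+1)%N.
Proof.
move=> k0; have ex : exists r, (k < start r)%N by exists k; exact: start_gt.
case: (ex_minnP ex) => -[|r] kr min.
  by move: kr; rewrite /= ltnS leqn0 => /eqP e; rewrite e in k0.
exists r; rewrite kr andbT leqNgt; apply/negP => /min.
by rewrite ltnn.
Qed.

Lemma superposition0 i : u i 0%N = 1.
Proof. by []. Qed.

Let block_sum r i : \sum_(start r <= k < start r.+1) normc (u i k) <= eps r (start r).
Proof.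
apply: le_trans (y_sum r i (start r.+1)).
rewrite [leRHS](big_cat_nat _ (n := start r)) ?(ltnW (startS r))//=.
apply: ler_wpDl; first by rewrite sumr_ge0// => k _; exact: normc_ge0.
by apply: ler_sum_nat => k h; rewrite (uE i h).
Qed.

(** Geometric series. The factor [b] is 1 for the norm of [u], and the inverse of the amplification
    [c r ^+ t] when the tail is shifted [t] times. *)
Let tail_sum r i (b : R) M : (forall q, (r <= q)%N -> (cmax q ^+ start q)^-1 <= b) ->
  \sum_(start r <= k < M) normc (u i k) <= 2 * 2 ^- r * b.
Proof.
move=> hb; have b0 : 0 <= b.
  apply: le_trans (hb r (leqnn r)); rewrite invr_ge0 exprn_ge0//.
  exact: le_trans (cmax1 r).
have key p : \sum_(start r <= k < start (r + p)) normc (u i k) <=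
    (2 * 2 ^- r - 2 * 2 ^- (r + p)) * b.
  elim: p => [|p IH]; first by rewrite addn0 big_geq// subrr mul0r.
  rewrite addnS (big_cat_nat _ (n := start (r + p)))//=; last 2 first.
  - by apply: start_mono; exact: leq_addr.
  - exact: ltnW (startS (r + p)).
  apply: (le_trans (lerD IH (block_sum _ _))).
  have : eps (r + p) (start (r + p)) <= 2 ^- (r + p) * b.
    by rewrite ler_wpM2l ?invr_ge0 ?exprn_ge0// hb// leq_addr.
  have -> : 2 ^- (r + p).+1 = 2 ^- (r + p) / 2 :> R by rewrite exprS invfM mulrC.
  by move=> h; lra.
have [Mr|rM] := leqP M (start r).
  by rewrite big_geq// mulr_ge0// mulr_ge0// invr_ge0 exprn_ge0.
have h := key M; apply: (@le_trans _ _ (\sum_(start r <= k < start (r + M)) normc (u i k))).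
  rewrite [leRHS](big_cat_nat _ (n := M))//=; last 2 first.
  - exact: ltnW.
  - by rewrite (leq_trans _ (ltnW (start_gt _)))// leq_addl.
  by rewrite lerDl sumr_ge0// => k _; exact: normc_ge0.
apply: (le_trans h); rewrite ler_wpM2r// gerBl mulr_ge0// invr_ge0 exprn_ge0//.
Qed.

Lemma superposition_sum i M : \sum_(0 <= k < M) normc (u i k) <= 3.
Proof.
case: M => [|M]; first by rewrite big_geq.
rewrite big_nat_recl// superposition0 ComplexField.Normc.normc1.
have := @tail_sum 0%N i 1 M.+1; rewrite expr0 invr1 !mulr1 /= big_add1/= => h.
suff : \sum_(0 <= k < M) normc (u i k.+1) <= 2 by lra.
apply: h => q _; rewrite invf_le1 ?exprn_ege1// exprn_gt0//.
exact: lt_le_trans (cmax1 q).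
Qed.

Lemma superposition_le1 i k : normc (u i k) <= 1.
Proof.
have [->|k0] := posnP k; first by rewrite superposition0 ComplexField.Normc.normc1.
have [r hr] := locate k0; rewrite (uE i hr).
apply: (@le_trans _ _ (eps r (start r))); last first.
  by apply: (le_trans (eps_le _ _)); rewrite invf_le1 ?exprn_ege1 ?ler1n// exprn_gt0.
apply: le_trans (y_sum r i k.+1).
by rewrite big_nat_recr//= lerDr sumr_ge0// => j _; exact: normc_ge0.
Qed.

(** Blocks before [r] are shifted out, since [t >= start r]. Later ones were taken small against any
    amplification by [t < start r.+1] shifts. In the second estimate the additional factor [|u|] is
    at most [2^-r] on block [r], whereas the other [m r] factors stay close to the target. *)
Lemma superposition_hit r lam (V : R) : box r lam ->
  (forall i M, \sum_(0 <= l < M) normc (v r i l) <= V) ->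
  exists t, (0 < t)%N /\ forall i M,
    \sum_(0 <= l < M) normc ((coef (lam i) t l)%:C * u i (t + l)%N ^+ m r - v r i l)
       <= 2 ^- r * 2 /\
    \sum_(0 <= l < M) coef (lam i) t l * normc (u i (t + l)%N) ^+ (m r).+1
       <= 2 ^- r * (2 + V).
Proof.
move=> hlam hV; have [supp _ hit] := svalP (yB r (start r)).
have [t [/andP[rt tB] ht]] := hit lam hlam; exists t.
split; first by apply: leq_trans rt; apply: leq_trans (start_gt r).
move=> i M; have {}ht := ht i M.
rewrite -/(y r) in ht.
have tS : (t < start r.+1)%N by apply: leq_trans tB _; rewrite /= leq_maxl.
have coef0 l : 0 < coef (lam i) t l by exact: expR_gt0.
have ucase l : u i (t + l)%N = y r i (t + l)%N /\ (t + l < start r.+1)%N \/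
    y r i (t + l)%N = 0 /\ (start r.+1 <= t + l)%N.
  have [h|h] := ltnP (t + l) (start r.+1).
    by left; split=> //; apply: uE; rewrite h andbT (leq_trans rt)// leq_addr.
  by right; split=> //; apply: y_supp; rewrite negb_and -(leqNgt (start r.+1)) h orbT.
(* Contribution of the later blocks to both estimates; higher powers of [u] are dropped because
   [|u| <= 1]. *)
pose tl l : R := if (start r.+1 <= t + l)%N then coef (lam i) t l * normc (u i (t + l)%N) else 0.
have tl0 l : 0 <= tl l.
  by rewrite /tl; case: ifP => // _; rewrite mulr_ge0 ?normc_ge0// ltW.
have tl_sum : \sum_(0 <= l < M) tl l <= 2 ^- r.
  have ct0 : 0 < c r ^+ t by rewrite exprn_gt0// (lt_le_trans ltr01).
  apply: (@le_trans _ _ (c r ^+ t * \sum_(start r.+1 <= k < M + t) normc (u i k))).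
    apply: (@le_trans _ _ (c r ^+ t *
        \sum_(0 <= l < M) (if (start r.+1 <= t + l)%N then normc (u i (t + l)%N) else 0))).
      rewrite mulr_sumr; apply: ler_sum => l _; rewrite /tl; case: ifP => _; last by rewrite mulr0.
      by rewrite ler_wpM2r ?normc_ge0// coefc.
    rewrite ler_pM2l//.
    pose g k : R := if (start r.+1 <= k)%N then normc (u i k) else 0.
    have g0 k : 0 <= g k by rewrite /g; case: ifP => // _; exact: normc_ge0.
    have -> : \sum_(start r.+1 <= k < M + t) normc (u i k) = \sum_(0 <= k < M + t) g k.
      rewrite (sum_nat_prefix0 (N := start r.+1)); last first.
        by move=> k; rewrite /g ltnNge => /negbTE->.
      by apply: eq_big_nat => k /andP[h _]; rewrite /g h.
    rewrite [leRHS](big_cat_nat _ (n := t)) ?leq_addl//=.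
    apply: ler_wpDl; first by rewrite sumr_ge0.
    have -> : \sum_(t <= k < M + t) g k = \sum_(0 <= l < M) g (l + t)%N.
      by rewrite -{1}(add0n t) big_addn addnK.
    by apply: ler_sum => l _; rewrite /g (addnC l).
  rewrite -ler_pdivlMl// mulrC.
  have -> : 2 ^- r / c r ^+ t = 2 * 2 ^- r.+1 * (c r ^+ t)^-1 :> R.
    by rewrite exprS invfM mulrA mulfV// mul1r.
  apply: tail_sum => q rq.
  have cq : 0 < cmax q by exact: lt_le_trans (cmax1 q).
  rewrite lef_pV2 ?posrE ?ct0 ?(exprn_gt0 _ cq)//.
  apply: (@le_trans _ _ (cmax q ^+ t)).
    by rewrite lerXn2r ?nnegrE ?(ltW cq) ?(le_trans _ (c1 r))// cmax_ge// ltnW.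
  by rewrite ler_weXn2l// (leq_trans (ltnW tS))// start_mono.
have epsr := eps_le r (start r).
split.
  apply: (@le_trans _ _ (\sum_(0 <= l < M)
     (normc ((coef (lam i) t l)%:C * y r i (t + l)%N ^+ m r - v r i l) + tl l))).
    apply: ler_sum => l _; have [[-> _]|[y0 h]] := ucase l; first by rewrite lerDl.
    rewrite /tl h; set a := (coef _ _ _)%:C.
    have -> : a * u i (t + l)%N ^+ m r - v r i l =
        (a * y r i (t + l)%N ^+ m r - v r i l) + a * u i (t + l)%N ^+ m r.
      by rewrite y0 expr0n (gtn_eqF (m0 r))/=; ring.
    apply: (le_trans (normcD _ _)); rewrite lerD2l.
    rewrite ComplexField.Normc.normcM normc_real gtr0_norm// ler_pM2l// normcX.
    by rewrite -[leRHS]expr1 ler_wiXn2l ?normc_ge0 ?superposition_le1.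
  rewrite big_split/=; lra.
apply: (@le_trans _ _ (\sum_(0 <= l < M) (2 ^- r * (normc ((coef (lam i) t l)%:C *
      y r i (t + l)%N ^+ m r - v r i l) + normc (v r i l)) + tl l))).
  apply: ler_sum => l _; have [[-> _]|[y0 h]] := ucase l.
    apply: ler_wpDr => //.
    rewrite exprSr mulrA mulrC ler_pM ?normc_ge0 ?mulr_ge0 ?exprn_ge0 ?normc_ge0//.
    - exact: ltW.
    - apply: le_trans epsr; apply: le_trans (y_sum r i (t + l).+1).
      by rewrite big_nat_recr//= lerDr sumr_ge0// => j _; exact: normc_ge0.
    set a := (coef _ _ _)%:C.
    have -> : coef (lam i) t l * normc (y r i (t + l)%N) ^+ m r = normc (a * y r i (t + l)%N ^+ m r).
      by rewrite ComplexField.Normc.normcM normc_real gtr0_norm// normcX.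
    by rewrite -{1}(subrK (v r i l) (a * _)) normcD.
  apply: ler_wpDl.
    by rewrite mulr_ge0 ?invr_ge0 ?exprn_ge0// addr_ge0 ?normc_ge0.
  rewrite /tl h ler_pM2l//.
  by rewrite -[leRHS]expr1 ler_wiXn2l ?normc_ge0 ?superposition_le1.
rewrite big_split/= -mulr_sumr big_split/=.
have h2 : 0 < 2 ^- r :> R by rewrite invr_gt0 exprn_gt0.
have h3 : 2 ^- r <= 1 :> R by rewrite invf_le1 ?exprn_ege1 ?ler1n// exprn_gt0.
have := hV i M; set S2 := \sum_(_ <= _ < _) normc (v r i _) => hS2.
rewrite mulrDr -addrA (mulrDr (2 ^- r)).
have : 2 ^- r * S2 <= 2 ^- r * V by rewrite ler_pM2l.
set S1 := \sum_(_ <= _ < _) normc (_ - _) in ht *.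
have : 2 ^- r * S1 <= 2 ^- r * 1 by rewrite ler_pM2l//; lra.
by lra.
Qed.

Lemma superposition_ex : exists u : 'I_d -> nat -> R[i],
  [/\ forall i, u i 0%N = 1, forall i M, \sum_(0 <= k < M) normc (u i k) <= 3,
    forall i k, normc (u i k) <= 1 &
    forall r lam (V : R), box r lam ->
    (forall i M, \sum_(0 <= l < M) normc (v r i l) <= V) ->
    exists t, (0 < t)%N /\ forall i M,
    \sum_(0 <= l < M) normc ((coef (lam i) t l)%:C * u i (t + l)%N ^+ m r - v r i l)
       <= 2 ^- r * 2 /\
    \sum_(0 <= l < M) coef (lam i) t l * normc (u i (t + l)%N) ^+ (m r).+1
       <= 2 ^- r * (2 + V)].
Proof.
exists u; split; [exact: superposition0|exact: superposition_sum|
  exact: superposition_le1|exact: superposition_hit].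
Qed.

End superposition.

(** * The hypercyclic algebra *)

(** [m] is the multiplicity of the root 0, and [c] the value at 0 of the cofactor. *)
Lemma poly_lowest_term (F : fieldType) (P : {poly F}) : P != 0 -> P.[0] = 0 ->
  exists (m : nat) (c : F) (Q : {poly F}),
    [/\ (0 < m)%N, c != 0 & P = c *: 'X^m + 'X^(m.+1) * Q].
Proof.
move=> P0 Pr; have [m [q]] := multiplicity_XsubC P 0; rewrite P0 /= subr0 => q0 PE.
have /factor_theorem[Q QE] : root (q - q.[0]%:P) 0.
  by rewrite /root hornerD hornerN hornerC subrr.
exists m, q.[0], Q; split=> //.
  case: m PE => // PE; move: Pr; rewrite PE expr0 mulr1 => /eqP h.
  by rewrite /root h in q0.
rewrite subr0 in QE; rewrite PE -mul_polyC exprS.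
by rewrite -{1}(subrK q.[0]%:P q) QE; ring.
Qed.

Lemma poly_bounded_unit_disc (R : realType) (Q : {poly R[i]}) :
  exists2 G : R, 0 <= G & forall z, normc z <= 1 -> normc Q.[z] <= G.
Proof.
elim/poly_ind: Q => [|Q a [G G0 hG]].
  by exists 0 => // z _; rewrite horner0 ComplexField.Normc.normc0.
exists (G + normc a); first by rewrite addr_ge0 ?normc_ge0.
move=> z z1; rewrite hornerMXaddC (le_trans (normcD _ _))// lerD2r.
rewrite ComplexField.Normc.normcM (le_trans _ (hG z z1))//.
by rewrite ler_piMr// normc_ge0.
Qed.

Lemma log_weightS (R : realType) (w : nat -> R) n :
  log_weight w n.+1 = log_weight w n + ln (w n.+1).
Proof. by rewrite /log_weight big_nat_recr. Qed.

Lemma expR_log_weight (R : realType) (w : nat -> R) n : is_weight w ->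
  expR (log_weight w n) = \prod_(1 <= i < n.+1) w i.
Proof.
move=> w0; elim: n => [|n IH]; first by rewrite /log_weight !big_geq// expR0.
by rewrite log_weightS expRD IH [RHS]big_nat_recr//= lnK// posrE w0.
Qed.

Lemma expR_log_weight_le (R : realType) (w : nat -> R) (c : R) n l : is_weight w ->
  (forall i, (1 <= i)%N -> w i <= c) ->
  expR (log_weight w (n + l) - log_weight w l) <= c ^+ n.
Proof.
move=> w0 wc; elim: n => [|n IH]; first by rewrite add0n subrr expR0 expr0.
rewrite addSn log_weightS addrAC expRD exprSr ler_pM ?expR_ge0//.
by rewrite lnK ?posrE ?w0// wc.
Qed.

Lemma rat_seq_sum (R : realType) (d : nat) (q : 'I_d -> seq (rat * rat)) :
  exists V : R, forall i M, \sum_(0 <= l < M) normc (rat_seq R (q i) l) <= V.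
Proof.
exists (\sum_(i < d) \sum_(0 <= l < size (q i)) normc (rat_seq R (q i) l)) => i M.
have S0 j N : 0 <= \sum_(0 <= l < N) normc (rat_seq R (q j) l).
  by apply: sumr_ge0 => l _; exact: normc_ge0.
apply: (@le_trans _ _ (\sum_(0 <= l < size (q i)) normc (rat_seq R (q i) l))); last first.
  by rewrite (bigD1 i)//= lerDl sumr_ge0// => j _; exact: S0.
apply: sum_nat_le_support => k; first exact: normc_ge0.
by move=> h; rewrite rat_seq_ge// ComplexField.Normc.normc0.
Qed.

(** Finitely many radii, one per coordinate, are merged into one by letting [e] tend to 0 from the
    right. *)
Lemma pow_seqX_nbhs (R : realType) (E : seq_space R) (d : nat)
  (z : pow d (seqX E)) (O : set (pow d (seqX E))) : nbhs z O ->
  exists2 e : R, 0 < e & forall z' : pow d (seqX E),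
    (forall i, seq_norm E (fun k => z' i k - z i k) < e) -> O z'.
Proof.
move=> /pow_nbhs_box[U [hU UO]].
have : \forall e \near (0 : R)^'+, forall i, forall y : seqX E,
    seq_norm E (fun k => y k - z i k) < e -> U i y.
  apply: filter_forall => i; have /seqX_nbhsP[e e0 he] := hU i.
  near=> e' => y ye; apply: he; apply: lt_le_trans ye _; apply: ltW.
  by near: e'; exact: nbhs_right_lt.
move=> h; have [e [e0 he]] := filter_ex (filterI (nbhs_right_gt (0 : R)) h).
by exists e => // z' hz; apply: UO => i; exact: he.
Unshelve. all: by end_near. Qed.

(** The 2-adic valuation takes each value at arbitrarily large integers. *)
Lemma recurrent_decoding (T : countType) (x0 : T) :
  exists f : nat -> T, forall x N, exists2 r, (N <= r)%N & f r = x.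
Proof.
exists (fun r => odflt x0 (unpickle (logn 2 r))) => x N.
exists (2 ^ pickle x * (2 * N).+1)%N.
  rewrite (leq_trans _ (leq_pmull _ _)) ?expn_gt0//.
  by rewrite mul2n -addnn -addnS leq_addr.
rewrite lognM ?expn_gt0// pfactorK// (_ : logn 2 (2 * N).+1 = 0%N) ?addn0 ?pickleK//.
by apply: logn_coprime; rewrite coprime2n /= oddM.
Qed.

Section main.
Variables (R : realType) (d : nat) (E : seq_space R) (alpha : R).
Variables (I : set R) (w : R -> nat -> R).
Hypotheses (d_ge1 : (1 <= d)%N) (alpha0 : 0 < alpha).
Hypothesis w_admissible : forall a, I a -> admissible E (w a).
Hypothesis w_continuous : continuous_family E d I w.
Variable C : R.
Hypotheses (C0 : 0 < C) (sepC : separating d alpha C).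

(** The side [del] depends on [K] but not on the box, target or power; hence countably many boxes of
    a grid suffice for each compact set. *)
Lemma compact_blocks (K : set R) (D1 D2 D3 : R) (N : nat) :
  compact K -> K `<=` I -> 0 < D1 -> 0 < D2 -> 0 < D3 ->
  (forall n, (N <= n)%N ->
    (D1 * n%:R `^ alpha).-lipschitz_K
      (fun a => \sum_(1 <= i < n.+1) ln (w a i))
    /\ ((D2 * expR (D3 * n%:R `^ alpha))%:E
         <= ereal_inf [set (\prod_(1 <= i < n.+1) w a i)%:E | a in K])%E) ->
  exists2 del : R, 0 < del & forall (j : 'I_d -> nat) (q : 'I_d -> seq (rat * rat))
    (m n0 : nat) (eps : R), (0 < m)%N -> 0 < eps ->
  exists (y : 'I_d -> nat -> R[i]) (B : nat),
  [/\ forall i k, ~~ (n0 <= k < B)%N -> y i k = 0,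
      forall i, \sum_(0 <= k < B) normc (y i k) <= eps
    & forall lam, in_box K del (fun i => (j i)%:R * del) lam ->
      exists t, (n0 <= t < B)%N /\ forall i M,
       \sum_(0 <= l < M) normc ((expR (log_weight (w (lam i)) (t + l) -
            log_weight (w (lam i)) l))%:C * y i (t + l)%N ^+ m -
            rat_seq R (q i) l) <= eps].
Proof.
move=> cK KI D10 D20 D30 growth.
pose del := D3 / 2 / (D1 * C).
have del0 : 0 < del by rewrite !divr_gt0// mulr_gt0.
exists del => // j q m n0 eps m0 eps0.
pose s := \max_(i < d) size (q i).
apply: (@exists_block R d alpha K (fun a => log_weight (w a)) D1 D3 (ln D2) C del N
  _ alpha0 D10 D30 C0 del0 sepC _ _ _ _ _ (fun i => rat_seq R (q i)) s) => //.
- rewrite (_ : D1 * del * C = D3 / 2)//.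
  by rewrite /del; field; rewrite !lt0r_neq0.
- move=> n x y Nn Kx Ky; have [lip _] := growth n Nn.
  exact: (lip (x, y) (conj Kx Ky)).
- move=> n x Nn Kx; have [_ inf] := growth n Nn.
  have [w0 _ _] := w_admissible (KI _ Kx).
  have : (ereal_inf [set (\prod_(1 <= i < n.+1) w a i)%:E | a in K] <=
          (\prod_(1 <= i < n.+1) w x i)%:E)%E by apply: ereal_inf_lbound; exists x.
  move=> /(le_trans inf); rewrite lee_fin -expR_log_weight// => h.
  by rewrite -ler_expR expRD lnK.
- move=> s'; exact: (log_weight_bounded d_ge1 w_continuous w_admissible).
- move=> s' e; exact: (log_weight_unif w_continuous w_admissible).
- move=> i l sl; apply: rat_seq_ge; apply: leq_trans sl.
  exact: (@leq_bigmax_cond _ xpredT (fun i => size (q i))).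
Qed.

End main.

Theorem corollary1p1 (R : realType) (d : nat) (E : seq_space R) (alpha : R)
  (I : set R) (w : R -> nat -> R)
  (d_ge1 : (1 <= d)%N)
  (alpha_itv : 0 < alpha < d%:R^-1)
  (I_pos : I `<=` [set a | 0 < a])
  (I_sigma_compact : sigma_compact I)
  (w_admissible : forall a, I a -> admissible E (w a))
  (w_continuous : continuous_family E d I w)
  (w_growth : forall I0 : set R, compact I0 -> I0 `<=` I ->
    exists (D1 D2 D3 : R) (N : nat),
      [/\ 0 < D1, 0 < D2, 0 < D3
        & forall n, (N <= n)%N ->
            (D1 * n%:R `^ alpha).-lipschitz_I0
              (fun a => \sum_(1 <= i < n.+1) ln (w a i))
            /\ ((D2 * expR (D3 * n%:R `^ alpha))%:E
                 <= ereal_inf [set (\prod_(1 <= i < n.+1) w a i)%:E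
                              | a in I0])%E]) :
  common_hypercyclic_algebra (@pow_mul R E d) (@pow_set R d I)
    (@prod_shift R E d w).
Proof.
have alpha0 : 0 < alpha by have /andP[] := alpha_itv.
have [C C0 sepC] := separating_ex d_ge1 alpha_itv.
have [K0 [cK0 IE]] := I_sigma_compact.
(* Increasing unions, so that all coordinates of a parameter lie in one of them. *)
pose K k := \big[setU/set0]_(j < k.+1) K0 j.
have KE k : K k = \bigcup_(j < k.+1) K0 j by rewrite bigcup_mkord.
have cK k : compact (K k) by apply: bigsetU_compact => j _; exact: cK0.
have KI k : K k `<=` I by rewrite IE KE => x [j _ h]; exists j.
have cover (lam : 'I_d -> R) : (forall i, I (lam i)) -> exists k, forall i, K k (lam i).
  move=> h; have h' i : exists k, K0 k (lam i).
    by have := h i; rewrite IE => -[k _ hk]; exists k.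
  have [f hf] := choice h'.
  exists (\max_(i < d) f i) => i; rewrite KE; exists (f i) => //=.
  by rewrite ltnS; exact: (@leq_bigmax_cond _ xpredT f i).
have data k : exists del, 0 < del /\
    forall (j : 'I_d -> nat) (q : 'I_d -> seq (rat * rat)) (m n0 : nat) (eps : R),
    (0 < m)%N -> 0 < eps ->
  exists (y : 'I_d -> nat -> R[i]) (B : nat),
  [/\ forall i k, ~~ (n0 <= k < B)%N -> y i k = 0,
      forall i, \sum_(0 <= k < B) normc (y i k) <= eps
    & forall lam, in_box (K k) del (fun i => (j i)%:R * del) lam ->
      exists t, (n0 <= t < B)%N /\ forall i M,
       \sum_(0 <= l < M) normc ((expR (log_weight (w (lam i)) (t + l) -
            log_weight (w (lam i)) l))%:C * y i (t + l)%N ^+ m -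
            rat_seq R (q i) l) <= eps].
  have [D1 [D2 [D3 [N [D10 D20 D30 growth]]]]] := w_growth (K k) (cK k) (KI k).
  have [del del0 hdel] := @compact_blocks R d E alpha I w d_ge1 alpha0 w_admissible
    w_continuous C C0 sepC (K k) D1 D2 D3 N (cK k) (KI k) D10 D20 D30 growth.
  by exists del.
have [del hdel] := choice data.
have bounds k : exists c, 1 <= c /\
    forall a, K k a -> forall n, (1 <= n)%N -> w a n <= c.
  have [c c1 hc] := weights_bounded d_ge1 w_continuous w_admissible (cK k) (KI k).
  by exists c.
have [c hc] := choice bounds.
(* Enumeration of the tasks (compact set, box, targets, power minus one), each of them recurring
   infinitely often so that the errors [2^-r] can be made small. *)
have [dec hdec] := recurrent_decoding
  ((0%N, [ffun => 0%N], [ffun => [::]], 0%N) :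
   nat * {ffun 'I_d -> nat} * {ffun 'I_d -> seq (rat * rat)} * nat).
pose kk r := (dec r).1.1.1.
pose box r := in_box (K (kk r)) (del (kk r)) (fun i => ((dec r).1.1.2 i)%:R * del (kk r)).
have [||||u [u0 usum ule1 uhit]] := @superposition_ex R d (fun a => log_weight (w a)) box
  (fun r => (dec r).2.+1) (fun r i => rat_seq R ((dec r).1.2 i)) (fun r => c (kk r)).
- by [].
- by move=> r; have [] := hc (kk r).
- move=> r lam i n l hlam; have [Klam _] := hlam i.
  have [w0 _ _] := w_admissible (lam i) (KI _ _ Klam).
  by apply: expR_log_weight_le => //; have [_] := hc (kk r); apply.
- move=> r n0 eps eps0; have [_ h] := hdel (kk r).
  exact: h.
have uX i : in_seq_space E (u i) := (l1_seq_space E (usum i)).1.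
(* The polynomials in [u] without constant term, with the same polynomial in every component. *)
pose A : set (pow d (seqX E)) := [set y | exists P : {poly R[i]},
  P.[0] = 0 /\ forall i k, y i k = P.[u i k]].
exists A; split.
- split.
  + by exists 0; split=> [|i k]; rewrite horner0.
  + move=> x y [P [P0 xP]] [Q [Q0 yQ]]; exists (P + Q); split=> [|i k].
      by rewrite hornerD P0 Q0 addr0.
    by rewrite hornerD -xP -yQ.
  + move=> a x [P [P0 xP]]; exists (a *: P); split=> [|i k].
      by rewrite hornerZ P0 mulr0.
    by rewrite hornerZ -xP.
  + move=> x y [P [P0 xP]] [Q [Q0 yQ]]; exists (P * Q); split=> [|i k].
      by rewrite hornerM P0 mul0r.
    by rewrite hornerM -xP -yQ.
- exists (fun i => SeqX (introT (seq_space_predP E _) (uX i))).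
    by exists 'X; split=> [|i k]; rewrite hornerX.
  apply/eqP => h; have /(congr1 (fun y : pow d (seqX E) => y (Ordinal d_ge1) 0%N)) /= := h.
  by rewrite u0 => /eqP; rewrite oner_eq0.
move=> x [[P [P0 xP]] x0] lam hlam.
have Pn0 : P != 0.
  apply/eqP => PE; apply: x0; apply/funext => i; apply: val_inj; apply/funext => k.
  by rewrite /= xP PE horner0.
have [m [a [Q [m0 a0 PE]]]] := poly_lowest_term Pn0 P0.
have [G G0 hG] := poly_bounded_unit_disc Q.
move=> O [z Oz] oO.
have [e e0 he] := pow_seqX_nbhs (open_nbhs_nbhs (conj oO Oz)).
have e4 : 0 < e / 4 by rewrite divr_gt0.
have approx i : exists q, in_seq_space E (fun k => a * rat_seq R q k - z i k) /\
    seq_norm E (fun k => a * rat_seq R q k - z i k) <= e / 4.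
  exact: rat_seq_dense (in_seqX (z i)) a0 e4.
have [q hq] := choice approx.
have [k hk] := cover lam hlam.
have [del0 _] := hdel k.
(* The grid cell containing [lam]; natural indices suffice because parameters are positive. *)
pose j i := Num.truncn (lam i / del k).
have [V hV] := rat_seq_sum R q.
have V0 : 0 <= V by have := hV (Ordinal d_ge1) 0%N; rewrite big_geq.
(* Up to the factor [2^-r], the error of the term [a X^m] plus that of [X^(m+1) Q], where [G] bounds
   [Q] on the unit disc. *)
pose H := normc a * 2 + G * (2 + V).
have [N hN] := @bernoulli_unbounded R 2 (H / (e / 4)) (ltr1n _ 2).
have [r Nr rE] := hdec (k, [ffun i => j i], [ffun i => q i], m.-1) N.
have Hr : 2 ^- r * H <= e / 4.
  rewrite mulrC ler_pdivrMr ?exprn_gt0// mulrC -ler_pdivrMr//.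
  by apply: (le_trans hN); rewrite ler_weXn2l// ler1n.
have boxr : box r lam.
  move=> i; rewrite /box /kk rE /= ffunE; split; first exact: hk.
  have l0 : 0 < lam i by apply: I_pos; exact: hlam.
  have /andP[t1 t2] := @truncn_itv R (lam i / del k) (divr_ge0 (ltW l0) (ltW del0)).
  rewrite -ler_pdivlMr// t1/= -[X in _ + X]mul1r -mulrDl natr1.
  by rewrite -ltr_pdivrMr.
have qE i : (dec r).1.2 i = q i by rewrite rE/= ffunE.
have hV' i M : \sum_(0 <= l < M) normc (rat_seq R ((dec r).1.2 i) l) <= V.
  by rewrite qE.
have [t [t0 ht]] := uhit r lam V boxr hV'.
exists (iter t (@prod_shift R E d w lam) x); split; last by exists t.
have iterE n y i : iter n (@prod_shift R E d w lam) y i = iter n (bw_shift (w (lam i))) (y i).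
  by elim: n => // n IH; rewrite !iterS -IH.
apply: he => i; rewrite iterE.
have [ht1 ht2] : (forall M, \sum_(0 <= l < M) normc ((expR (log_weight (w (lam i)) (t + l) -
            log_weight (w (lam i)) l))%:C * u i (t + l)%N ^+ m - rat_seq R (q i) l) <= 2 ^- r * 2) /\
   forall M, \sum_(0 <= l < M) (expR (log_weight (w (lam i)) (t + l) -
            log_weight (w (lam i)) l)) * normc (u i (t + l)%N) ^+ m.+1 <= 2 ^- r * (2 + V).
  have dE : (dec r).2.+1 = m by rewrite rE/= prednK.
  by split=> M; have := ht i M; rewrite dE qE => -[].
(* Error between the iterate and [a] times the rational target; the distance from the latter to [z]
   is added at the end, for a total of at most [e / 2]. *)
pose f1 l : R[i] := (expR (log_weight (w (lam i)) (t + l) -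
            log_weight (w (lam i)) l))%:C * P.[u i (t + l)%N] - a * rat_seq R (q i) l.
have [in1 n1] : in_seq_space E f1 /\ seq_norm E f1 <= e / 4.
  apply: l1_seq_space => M; apply: le_trans Hr.
  rewrite /H mulrDr !(mulrCA (2 ^- r)).
  apply: (@le_trans _ _ (\sum_(0 <= l < M) (normc a * normc ((expR (log_weight (w (lam i)) (t + l) -
            log_weight (w (lam i)) l))%:C * u i (t + l)%N ^+ m - rat_seq R (q i) l) +
     G * (expR (log_weight (w (lam i)) (t + l) -
            log_weight (w (lam i)) l) * normc (u i (t + l)%N) ^+ m.+1)))); last first.
    by rewrite big_split/= -!mulr_sumr lerD// ler_wpM2l// normc_ge0.
  apply: ler_sum => l _; rewrite /f1; set b := expR _.
  have -> : b%:C * P.[u i (t + l)%N] - a * rat_seq R (q i) l =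
     a * (b%:C * u i (t + l)%N ^+ m - rat_seq R (q i) l) +
     Q.[u i (t + l)%N] * (b%:C * u i (t + l)%N ^+ m.+1).
    by rewrite PE hornerD hornerZ hornerM !hornerXn; ring.
  apply: (le_trans (normcD _ _)); rewrite !ComplexField.Normc.normcM !normcX normc_real.
  rewrite lerD2l (ger0_norm (expR_ge0 _)) ler_wpM2r ?hG//.
  by rewrite mulr_ge0 ?expR_ge0 ?exprn_ge0 ?normc_ge0.
have [in2 n2] := hq i.
have -> : (fun l => iter t (bw_shift (w (lam i))) (x i) l - z i l) =
    f1 + (fun l => a * rat_seq R (q i) l - z i l).
  apply/funext => l; rewrite (iter_bw_shift _ _ _ (w_admissible _ (hlam i))) xP.
  by rewrite /GRing.add /= /f1 addrA subrK.
have [_ n3] := seq_spaceD in1 in2.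
by apply: (le_lt_trans n3); lra.
Qed.
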